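(* Let $\mathbf M=(M_1,\dots,M_k)$ be a flag matroid of rank $(r_1,\dots,r_k)$ on $[n]$ with rank functions $\operatorname{rk}_1,\dots,\operatorname{rk}_k$. Let \[\varphi=\sum_{\lambda\in\Lambda}a_\lambda\mathbf t^{w_\lambda}\operatorname{Hilb}(\operatorname{Cone}_{\mathbf B_\lambda}(\mathbf M))\] be a finite sum with $a_\lambda\in\mathbb Q$, $w_\lambda\in\mathbb Z_{\ge0}^n$, and $\mathbf B_\lambda$ bases of $\mathbf M$ (repetitions allowed), such that all $w_\lambda$ have the same coordinate sum $c$, and suppose $\varphi\in\mathbb Q[t_1^{\pm1},\dots,t_n^{\pm1}]$. Let $\widetilde P=\operatorname{Conv}\{\sigma\cdot w_\lambda:\sigma\in S_n,\lambda\in\Lambda\}$ (with $S_n$ permuting coordinates). Let $v$ be a vertex of $\widetilde P$, written $v=\mathbf e_{S_1}+\cdots+\mathbf e_{S_m}$ with $S_1\subseteq\cdots\subseteq S_m\subseteq[n]$, and fix a basis $\mathbf B=(B_1,\dots,B_k)$ of $\mathbf M$ with $|S_i\cap B_j|=\operatorname{rk}_j(S_i)$ for all $1\le i\le m$, $1\le j\le k$ (equivalently, $\mathbf e_{\mathbf B}$ is a vertex of the face of $Q(\mathbf M)$ maximizing $\langle v,\cdot\rangle$). Then the coefficient of $\mathbf t^v$ in $\varphi$ equals $\sum a_\lambda$ over those $\lambda$ with $w_\lambda=v$ and $\mathbf B_\lambda=\mathbf B$.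
   Context: A flag matroid is a sequence $(M_1,\dots,M_k)$ of matroids on $[n]$ with $\operatorname{rk}_{M_{i+1}}(B)-\operatorname{rk}_{M_{i+1}}(A)\ge\operatorname{rk}_{M_i}(B)-\operatorname{rk}_{M_i}(A)$ for all $A\subseteq B\subseteq[n]$ (repetitions allowed). Its bases are flags $\mathbf B=(B_1\subseteq\cdots\subseteq B_k)$ with $B_i$ a basis of $M_i$; $\mathbf e_S=\sum_{i\in S}\mathbf e_i$, $\mathbf e_{\mathbf B}=\sum_i\mathbf e_{B_i}$; $Q(\mathbf M)=\operatorname{Conv}\{\mathbf e_{\mathbf B}\}$; $\operatorname{Cone}_{\mathbf B}(\mathbf M)$ is the cone generated by $Q(\mathbf M)-\mathbf e_{\mathbf B}$; $\operatorname{Hilb}(C)\in\mathbb Q(t_1,\dots,t_n)$ is the multigraded Hilbert series of $\mathbb C[\mathbf t^\lambda:\lambda\in C\cap\mathbb Z^n]$, i.e. the rational function represented by $\sum_{\lambda\in C\cap\mathbb Z^n}\mathbf t^\lambda$. *)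

(* Defs.v *)
From mathcomp Require Import all_boot all_order all_algebra all_fingroup.
From mathcomp Require Import finmap mpoly boolp classical_sets.

Set Implicit Arguments.
Unset Strict Implicit.
Unset Printing Implicit Defensive.

Import Order.TTheory GRing.Theory Num.Theory.
Local Open Scope ring_scope.

Record matroid (n : nat) := Matroid {
  bases : {set {set 'I_n}};
  bases_neq0 : bases != finset.set0;
  bases_exchange : forall A B x, A \in bases -> B \in bases -> x \in A :\: B ->
    exists2 y, y \in B :\: A & y |: (A :\ x) \in bases }.

Definition rk n (M : matroid n) (A : {set 'I_n}) : nat :=
  (\max_(B in bases M) #|A :&: B|)%N.

(* [rk] is monotone, so no subtraction below is truncated. *)
Record flag_matroid (n k : nat) := FlagMatroid {
  constituent :> 'I_k -> matroid n;
  flag_quotient : forall i j : 'I_k, j = i.+1 :> nat ->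
    forall A B : {set 'I_n}, A \subset B ->
    (rk (constituent i) B - rk (constituent i) A
       <= rk (constituent j) B - rk (constituent j) A)%N }.

Notation flag n k := {ffun 'I_k -> {set 'I_n}}.

Definition is_chain n m (S : 'I_m -> {set 'I_n}) : Prop :=
  forall i j : 'I_m, (i <= j)%N -> S i \subset S j.

Definition flag_basis n k (M : flag_matroid n k) (B : flag n k) : Prop :=
  is_chain B /\ forall i, B i \in bases (M i).

Definition evec (A : pzRingType) n (S : {set 'I_n}) : 'rV[A]_n :=
  \row_i (i \in S)%:R.
Arguments evec A {n} S.

Definition evec_flag (A : pzRingType) n k (B : flag n k) : 'rV[A]_n :=
  \sum_(i < k) evec A (B i).
Arguments evec_flag A {n k} B.

Definition int_point (R : realFieldType) n (x : 'rV[int]_n) : 'rV[R]_n :=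
  map_mx intr x.
Arguments int_point R {n} x.

Section Convexity.
Variables (R : realFieldType) (n : nat).
Implicit Types (X P : set 'rV[R]_n) (x v : 'rV[R]_n).

Definition Conv X : set 'rV[R]_n := fun x =>
  exists (m : nat) (c : 'I_m -> R) (p : 'I_m -> 'rV[R]_n),
    [/\ forall i, 0 <= c i, \sum_i c i = 1, forall i, X (p i)
      & x = \sum_i c i *: p i].

Definition Cone X : set 'rV[R]_n := fun x =>
  exists (m : nat) (c : 'I_m -> R) (p : 'I_m -> 'rV[R]_n),
    [/\ forall i, 0 <= c i, forall i, X (p i) & x = \sum_i c i *: p i].

Definition dot x v : R := \sum_i x 0 i * v 0 i.

(* A vertex is a zero-dimensional face: [v] is the unique maximizer on [P] of
   some linear functional. *)
Definition is_vertex P v : Prop :=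
  P v /\ exists u, forall x, P x -> x <> v -> dot u x < dot u v.

End Convexity.

Definition flag_polytope (R : realFieldType) n k (M : flag_matroid n k) :
    set 'rV[R]_n :=
  Conv (fun x => exists2 B, flag_basis M B & x = evec_flag R B).
Arguments flag_polytope R {n k} M.

Definition basis_cone (R : realFieldType) n k (M : flag_matroid n k)
    (B : flag n k) : set 'rV[R]_n :=
  Cone (fun x => exists2 q, flag_polytope R M q & x = q - evec_flag R B).
Arguments basis_cone R {n k} M B.

Definition perm_polytope (R : realFieldType) n (I : Type)
    (w : I -> 'rV[int]_n) : set 'rV[R]_n :=
  Conv (fun x => exists (s : 'S_n) (l : I), x = int_point R (col_perm s (w l))).
Arguments perm_polytope R {n I} w.

Notation ratfun n := {fraction {mpoly rat[n]}}.

(* A Laurent polynomial is stored as its finitely supported coefficient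
   function on Z^n; [laurent_ratfun] embeds it into Q(t_1, ..., t_n). *)
Notation laurent n := {fsfun 'rV[int]_n -> rat with 0}.

Definition ratC n (a : rat) : ratfun n := tofrac (a%:MP_[n]).
Arguments ratC {n} a.

Definition tmon n (x : 'rV[int]_n) : ratfun n :=
  \prod_(i < n) (tofrac ('X_i : {mpoly rat[n]}) ^ x 0 i).

Definition laurent_ratfun n (c : laurent n) : ratfun n :=
  \sum_(x <- finsupp c) ratC (c x) * tmon x.

(* A formal series [s : 'rV[int]_n -> rat] stands for sum_x s(x) t^x.  Such
   two-sided infinite series form a module over the Laurent polynomials. *)
Definition laurent_mul_series n (q : laurent n) (s : 'rV[int]_n -> rat) :
    'rV[int]_n -> rat :=
  fun x => \sum_(y <- finsupp q) q y * s (x - y).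

Definition represents n (f : ratfun n) (s : 'rV[int]_n -> rat) : Prop :=
  exists q p : laurent n,
    [/\ laurent_ratfun q != 0, laurent_mul_series q s =1 p
      & f = laurent_ratfun p / laurent_ratfun q].

Definition lattice_series (R : realFieldType) n (C : set 'rV[R]_n) :
    'rV[int]_n -> rat :=
  fun x => (`[< C (int_point R x) >])%:R.

(* By [represents_unique] below there is at most one candidate; the default
   value 0 is only taken when the series represents no rational function. *)
Definition Hilb (R : realFieldType) n (C : set 'rV[R]_n) : ratfun n :=
  xget 0 (fun f => represents f (lattice_series C)).

Lemma ratC_sum n (I : Type) (r : seq I) (F : I -> rat) :
  ratC (\sum_(i <- r) F i) = \sum_(i <- r) ratC (F i) :> ratfun n.
Proof. by rewrite /ratC !raddf_sum. Qed.

Lemma ratCM n a b : ratC (a * b) = ratC a * ratC b :> ratfun n.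
Proof. by rewrite /ratC mpolyCM rmorphM. Qed.

Lemma ratC0 n : ratC 0 = 0 :> ratfun n.
Proof. by rewrite /ratC mpolyC0 rmorph0. Qed.

Lemma tmonD n (x y : 'rV[int]_n) : tmon (x + y) = tmon x * tmon y.
Proof.
rewrite /tmon -big_split; apply: eq_bigr => i _ /=.
rewrite mxE expfzDr // tofrac_eq0; apply/eqP => /(congr1 (mcoeff U_(i)%MM)).
by rewrite mcoeffX eqxx mcoeff0 => /eqP; rewrite oner_eq0.
Qed.

Lemma laurent_ratfun_seq n (c : laurent n) (Z : seq 'rV[int]_n) :
  uniq Z -> {subset finsupp c <= Z} ->
  laurent_ratfun c = \sum_(x <- Z) ratC (c x) * tmon x.
Proof.
move=> uZ sZ; rewrite (bigID (mem (finsupp c))) /= [X in _ + X]big1_seq.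
  rewrite addr0 -big_filter; apply: perm_big; apply: uniq_perm.
  - exact: fset_uniq.
  - exact: filter_uniq.
  by move=> x; rewrite mem_filter; case: (boolP (x \in finsupp c)) => //= /sZ.
by move=> x /andP[xc _]; rewrite fsfun_dflt // ratC0 mul0r.
Qed.

Lemma laurent_ratfunM n (q c : laurent n) (Z : seq 'rV[int]_n) :
    uniq Z ->
    (forall y x, y \in finsupp q -> x \in finsupp c -> x + y \in Z) ->
  laurent_ratfun q * laurent_ratfun c =
    \sum_(z <- Z) ratC (laurent_mul_series q c z) * tmon z.
Proof.
move=> uZ sZ; rewrite {1}/laurent_ratfun big_distrl /=.
under [RHS]eq_bigr do rewrite /laurent_mul_series ratC_sum big_distrl /=.
rewrite exchange_big /=; apply: eq_big_seq => y yq.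
rewrite (@laurent_ratfun_seq _ c [seq z - y | z <- Z]); last 2 first.
- by rewrite map_inj_uniq // => a b /addIr.
- by move=> x xc; apply/mapP; exists (x + y); rewrite ?addrK // sZ.
rewrite big_map big_distrr /=; apply: eq_bigr => z _.
have -> : tmon z = tmon y * tmon (z - y) by rewrite -tmonD addrC subrK.
by rewrite ratCM mulrACA.
Qed.

Lemma laurent_mul_seriesC n (q q' : laurent n) (s : 'rV[int]_n -> rat) x :
  laurent_mul_series q (laurent_mul_series q' s) x =
  laurent_mul_series q' (laurent_mul_series q s) x.
Proof.
rewrite /laurent_mul_series.
under eq_bigr do rewrite big_distrr /=.
under [RHS]eq_bigr do rewrite big_distrr /=.
rewrite exchange_big /=; apply: eq_bigr => y _; apply: eq_bigr => z _.
by rewrite mulrCA addrAC.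
Qed.

Lemma div_eq_cross (F : fieldType) (x y z t : F) :
  y != 0 -> t != 0 -> t * x = y * z -> x / y = z / t.
Proof.
by move=> y0 t0 e; apply/eqP; rewrite eqr_div // mulrC e mulrC.
Qed.

Lemma represents_unique n (f g : ratfun n) (s : 'rV[int]_n -> rat) :
  represents f s -> represents g s -> f = g.
Proof.
move=> [q [p [q0 qs ->]]] [q' [p' [q'0 qs' ->]]].
apply: (div_eq_cross q0 q'0).
pose add (A B : seq 'rV[int]_n) := [seq x + y | y <- A, x <- B].
pose Z := undup (add (finsupp q') (finsupp p) ++ add (finsupp q) (finsupp p')).
have sZ1 y x : y \in finsupp q' -> x \in finsupp p -> x + y \in Z.
  by move=> yq xp; rewrite mem_undup mem_cat; apply/orP; left;
     apply/allpairsP; exists (y, x).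
have sZ2 y x : y \in finsupp q -> x \in finsupp p' -> x + y \in Z.
  by move=> yq xp; rewrite mem_undup mem_cat; apply/orP; right;
     apply/allpairsP; exists (y, x).
rewrite (laurent_ratfunM (undup_uniq _) sZ1) (laurent_ratfunM (undup_uniq _) sZ2).
apply: eq_bigr => z _; congr (ratC _ * _).
rewrite -(_ : laurent_mul_series q' (laurent_mul_series q s) z =
              laurent_mul_series q' p z); last first.
  by apply: eq_bigr => y _; rewrite qs.
rewrite laurent_mul_seriesC; apply: eq_bigr => y _; by rewrite qs'.
Qed.

Lemma Hilb_eq (R : realFieldType) n (C : set 'rV[R]_n) f :
  represents f (lattice_series C) -> Hilb C = f.
Proof.
move=> rf; apply: xget_unique => // g rg; exact: represents_unique rg rf.
Qed.

(* Main.v *)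
Require Import Defs.
From mathcomp Require Import all_boot all_order all_algebra all_fingroup.
From mathcomp Require Import finmap mpoly boolp classical_sets.
From mathcomp Require Import zify ring lra.

Set Implicit Arguments.
Unset Strict Implicit.
Unset Printing Implicit Defensive.

Import Order.TTheory GRing.Theory Num.Theory.
Local Open Scope ring_scope.

(** Order the exponents lexicographically by a functional [u] exposing [v] on
    the permutation-invariant polytope (averaged over the stabilizer of [v]),
    then by [e_B], then by the coordinates. Expand every Hilbert series in
    descending exponents for this order. Basis exchange shows that each
    [Cone_{B'}(M)] is generated by the roots [e_i - e_j] it contains, which form
    a strict order [D] on [[n]]. If [r = e_a - e_b] with [a], [b] incomparable
    in [D], then [C] + [C + R r] = [C + R+ r] + [C - R+ r] as indicator
    functions, and [C + R r] has Hilbert series 0; hence [Hilb(C)] is the sum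
    over the linear extensions of [D] of products of geometric series
    [1 / (1 - t^r)], [r] running over consecutive pairs. Such a product expands
    with constant term 1 if all its roots are negative and 0 otherwise, and with
    all other exponents negative. So [Hilb(Cone_{B'}(M))] has constant term 1 if
    [B' = B] and 0 otherwise, and since [v] is the largest of the [w_l], only
    the terms with [w_l = v] and [B_l = B] contribute to [t^v]. *)

(** * Matroid rank functions, basis exchange and quotients *)

Section Matroids.
Import fintype boot.finset.

Section MatroidRank.
Variables (n : nat) (M : matroid n).
Implicit Types (A B I J X : {set 'I_n}) (x y z : 'I_n).

Lemma card_exchange A x y : x \in A -> y \notin A -> #|y |: (A :\ x)| = #|A|.
Proof.
move=> xA yA; rewrite cardsU1 !inE (negPf yA) andbF (cardsD1 x A) xA //.
Qed.

(** Exchanging [x] for an element of [B :\: A] keeps [#|A|] and shrinks [A :\: B]. Once [A] lies in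
    [B], an element of [B :\: A] would have to be exchanged for one of the empty set [A :\: B]. *)
Lemma card_bases A B : A \in bases M -> B \in bases M -> #|A| = #|B|.
Proof.
have [d] := ubnP #|A :\: B|; elim: d A => // d IH A; rewrite ltnS => le_d AM BM.
have [AB0|] := set_0Vmem (A :\: B); last first.
  move=> [x xAB]; have [y yBA AM'] := bases_exchange AM BM xAB.
  move: xAB yBA; rewrite !inE => /andP[xB xA] /andP[yA yB].
  rewrite -(card_exchange xA yA); apply: IH => //.
  apply: leq_trans le_d; apply: proper_card; apply/properP; split.
    apply/subsetP => z; rewrite !inE => /andP[zB /orP[/eqP zy|/andP[_ ->]]].
      by rewrite zy yB in zB.
    by rewrite zB.
  by exists x; rewrite !inE ?xB ?xA //= eqxx orbF; apply: contraNneq xB => ->.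
have sAB : A \subset B by rewrite -setD_eq0 AB0.
have [BA0|] := set_0Vmem (B :\: A).
  by apply/eqP; rewrite eqn_leq !subset_leq_card // -setD_eq0 BA0.
by move=> [y /(bases_exchange BM AM)[z]]; rewrite AB0 inE.
Qed.

Lemma rk_ge A B : B \in bases M -> (#|A :&: B| <= rk M A)%N.
Proof.
exact: (@leq_bigmax_cond _ (fun C => C \in bases M) (fun C => #|A :&: C|)).
Qed.

Lemma rk_attained A : exists2 B, B \in bases M & #|A :&: B| = rk M A.
Proof.
have /set0Pn[B0 B0M] := bases_neq0 M.
have gt0 : (0 < #|bases M|)%N by apply/card_gt0P; exists B0.
by have [B BM E] := eq_bigmax_cond (fun B => #|A :&: B|) gt0; exists B.
Qed.

Lemma rkS A B : A \subset B -> (rk M A <= rk M B)%N.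
Proof.
move=> sAB; have [C CM <-] := rk_attained A.
by apply: leq_trans (rk_ge _ CM); rewrite subset_leq_card // setSI.
Qed.

Lemma rk_eqS A B : A \subset B -> ~ (rk M A < rk M B)%N -> rk M B = rk M A.
Proof. by move=> /rkS; lia. Qed.

(* Among the bases containing [I], one closest to a basis attaining the rank
   of [X] differs from it only inside [I]. *)
Lemma extend_in I X B0 : B0 \in bases M -> I \subset B0 -> I \subset X ->
  exists B, [/\ B \in bases M, I \subset B & #|X :&: B| = rk M X].
Proof.
move=> B0M IB0 IX; have [B' B'M B'X] := rk_attained X.
pose Q B := (B \in bases M) && (I \subset B).
have QB0 : Q B0 by rewrite /Q B0M.
case: (arg_maxnP (fun B => #|B :&: B'|) QB0) => B /andP[BM IB] maxB.
exists B; split => //.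
have BsI : B :\: B' \subset I.
  apply/subsetP => x xBB'; apply/negPn/negP => xI.
  have [y] := bases_exchange BM B'M xBB'.
  move: xBB'; rewrite !inE => /andP[xB' xB] /andP[yB yB'] B1M.
  have : Q (y |: (B :\ x)).
    rewrite /Q B1M; apply/subsetP => z zI; rewrite !inE (subsetP IB _ zI) andbT.
    by rewrite (contraNneq _ xI) ?orbT // => <-.
  move=> /maxB; apply/negP; rewrite -ltnNge; apply: proper_card.
  apply/properP; split; last by exists y; rewrite !inE ?eqxx ?yB' // (negPf yB).
  apply/subsetP => z; rewrite !inE => /andP[zB zB']; rewrite zB zB' !andbT.
  by rewrite (contraNneq _ xB') ?orbT // => <-.
apply/eqP; rewrite eqn_leq rk_ge // -B'X.
have := cardsID X B; have := cardsID X B'; rewrite (card_bases BM B'M) => <-.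
rewrite [B :&: X]setIC [B' :&: X]setIC.
have : (#|B :\: X| <= #|B' :\: X|)%N; last by lia.
apply: subset_leq_card; apply/subsetP => z; rewrite !inE => /andP[zX zB].
rewrite zX; apply: contraNT zX => zB'; apply: (subsetP IX).
by apply: (subsetP BsI); rewrite !inE zB'.
Qed.

(** If the rank rose, a maximal independent part of [J] would extend to a basis attaining the rank
    of [J :|: A]. A new element [z] would give [z |: J] rank above [rk M J], which is impossible
    both for [z] in [J] and for [z] in [A]. *)
Lemma rkU_stable J A : (forall z, z \in A -> rk M (z |: J) = rk M J) ->
  rk M (J :|: A) = rk M J.
Proof.
move=> stab; apply: rk_eqS (subsetUl _ _) _ => lt; have [B0 B0M B0J] := rk_attained J.
have [|B [BM IB BX]] := extend_in B0M (subsetIr J B0) (X := J :|: A).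
  by rewrite (subset_trans (subsetIl _ _)) ?subsetUl.
have /subsetPn[z] : ~~ ((J :|: A) :&: B \subset J :&: B0).
  by apply/negP => /subset_leq_card; rewrite BX B0J leqNgt lt.
rewrite !inE => /andP[zX zB] zI.
have ge : (rk M J < #|(z |: J) :&: B|)%N.
  rewrite -B0J; apply: proper_card; apply/properP; split.
    by rewrite subsetI IB andbT (subset_trans (subsetIl _ _)) ?subsetU1.
  by exists z; rewrite !inE ?eqxx.
have [zJ|zJ] := boolP (z \in J).
  by have := rk_ge J BM; rewrite (_ : z |: J = J) in ge;
    [lia | apply/setUidPr; rewrite sub1set].
move: zX; rewrite (negPf zJ) /= => /stab E.
by have := rk_ge (z |: J) BM; rewrite E; lia.
Qed.

(** Monotonicity of matroid closure. A maximal independent part of [A] is extended inside [X], then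
    inside [y |: X]; if the last extension gained [y], then [y] would already raise the rank of
    [A]. *)
Lemma rkU1_stable A X y : A \subset X -> rk M (y |: A) = rk M A ->
  rk M (y |: X) = rk M X.
Proof.
move=> AX E; apply: rk_eqS (subsetU1 _ _) _ => lt; have [B0 B0M B0A] := rk_attained A.
have [|B1 [B1M IB1 B1X]] := extend_in B0M (subsetIr A B0) (X := X).
  by rewrite (subset_trans (subsetIl _ _)).
have [|B [BM IB BX]] := extend_in B1M (subsetIr X B1) (X := y |: X).
  by rewrite (subset_trans (subsetIl _ _)) ?subsetU1.
have yB : y \in B.
  apply: contraLR lt => yB; rewrite -leqNgt -BX.
  apply: leq_trans (rk_ge X BM); apply: subset_leq_card.
  apply/subsetP => z; rewrite !inE => /andP[/orP[/eqP->|->] zB //].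
  by rewrite zB in yB.
have yX : y \notin X.
  apply: contraL lt => yX; rewrite (_ : y |: X = X) ?ltnn //.
  by apply/setUidPr; rewrite sub1set.
have : (rk M A < #|(y |: A) :&: B|)%N.
  rewrite -B0A; apply: proper_card; apply/properP; split.
    apply/subsetP => z zA; have zB1 := subsetP IB1 _ zA.
    move: zA; rewrite !inE => /andP[zA _]; rewrite zA orbT /=.
    by apply: (subsetP IB); rewrite !inE zB1 (subsetP AX _ zA).
  exists y; rewrite !inE ?eqxx ?yB //.
  by apply: contraNN yX => /andP[/(subsetP AX)].
by rewrite ltnNge -E rk_ge.
Qed.

(* [A] contains the fundamental circuit of [y] minus [y]. *)
Lemma rk_circuit A B y : B \in bases M -> A \subset B -> y \notin B ->
    (forall z, z \in B -> y |: (B :\ z) \in bases M -> z \in A) ->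
  rk M (y |: A) = rk M A.
Proof.
move=> BM AB yB circ; apply: rk_eqS (subsetU1 _ _) _ => lt.
have [B0 B0M B0A] := rk_attained (y |: A).
have rkA : rk M A = #|A|.
  have leA : (#|A| <= rk M A)%N by rewrite -{1}(setIidPl AB) rk_ge.
  apply/eqP; rewrite eqn_leq leA andbT.
  have [C CM <-] := rk_attained A; exact: subset_leq_card (subsetIl _ _).
(* A rise in rank makes [y |: A] independent; extended inside [y |: B] it becomes [B] with some [z]
   replaced by [y]. Then [circ] puts [z] in [A], although [A] survives in the new basis. *)
have yAB0 : y |: A \subset B0.
  apply/setIidPl/eqP; rewrite eqEcard subsetIl B0A.
  by apply: leq_trans lt; rewrite rkA cardsU1 -[_.+1]add1n leq_add2r leq_b1.
have [|B1 [B1M IB1 B1X]] := extend_in B0M yAB0 (X := y |: B).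
  exact: setUS.
have sB1 : B1 \subset y |: B.
  apply/setIidPr/eqP; rewrite eqEcard subsetIr B1X (card_bases B1M BM).
  by apply: leq_trans (rk_ge _ BM); rewrite setIC (setIidPl (subsetU1 _ _)).
have yB1 : y \in B1 by apply: (subsetP IB1); rewrite !inE eqxx.
have /subsetPn[z zB zB1] : ~~ (B \subset B1).
  apply: contra yB => sBB1; suff /eqP<- : B1 == B by [].
  by rewrite eq_sym eqEcard sBB1 (card_bases B1M BM) leqnn.
have EB1 : B1 = y |: (B :\ z).
  apply/eqP; rewrite eqEcard card_exchange // (card_bases B1M BM) leqnn andbT.
  apply/subsetP => t tB1; have := subsetP sB1 _ tB1; rewrite !inE.
  by case/orP=> -> //; rewrite andbT (contraNneq _ zB1) ?orbT // => <-.
have := circ z zB; rewrite -EB1 => /(_ B1M) zA.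
by move: zB1; rewrite (subsetP IB1) // !inE zA orbT.
Qed.

Lemma bases_of_rk B x y : B \in bases M -> x \in B ->
  (rk M (B :\ x) < rk M (y |: (B :\ x)))%N -> y |: (B :\ x) \in bases M.
Proof.
move=> BM xB lt; have [B0 B0M B0X] := rk_attained (y |: (B :\ x)).
have le : (#|B :\ x| <= rk M (B :\ x))%N.
  by rewrite -{1}(setIidPl (subD1set B x)) rk_ge.
have cB : #|B| = #|B :\ x|.+1 by rewrite (cardsD1 x B) xB.
have B0E : B0 = (y |: (B :\ x)) :&: B0.
  by apply/eqP; rewrite eq_sym eqEcard subsetIr B0X (card_bases B0M BM) cB; lia.
have sB0 : B0 \subset y |: (B :\ x) by apply/setIidPr.
rewrite -(_ : B0 = y |: (B :\ x)) //; apply/eqP; rewrite eqEcard sB0.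
by rewrite (card_bases B0M BM) cB cardsU1; case: (y \notin _); lia.
Qed.

Lemma rk_of_bases B x y : B \in bases M -> x \in B ->
  y |: (B :\ x) \in bases M -> (rk M (B :\ x) < rk M (y |: (B :\ x)))%N.
Proof.
move=> BM xB B'M; have := rk_ge (y |: (B :\ x)) B'M; rewrite setIid.
rewrite (card_bases B'M BM) (cardsD1 x B) xB add1n; apply: leq_trans.
rewrite ltnS; have [C CM <-] := rk_attained (B :\ x).
exact: subset_leq_card (subsetIl _ _).
Qed.

End MatroidRank.

(** [M'] is a matroid quotient of [M]; transitivity carries [flag_quotient] from consecutive
    constituents to arbitrary ones. *)
Definition rk_quotient n (M' M : matroid n) : Prop :=
  forall A B : {set 'I_n}, A \subset B -> (rk M' B - rk M' A <= rk M B - rk M A)%N.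

(* Applied with [M' = M] this is the symmetric exchange property; with
   [M'] a proper quotient it gives the exchange properties of flags. *)
Lemma quotient_exchange n (M' M : matroid n) (B J : {set 'I_n}) y :
    rk_quotient M' M -> B \in bases M -> y \notin B ->
    (rk M' J < rk M' (y |: J))%N ->
  exists z, [/\ z \in B, (rk M' J < rk M' (z |: J))%N
              & y |: (B :\ z) \in bases M].
Proof.
move=> quo BM yB lt.
(* If no [z] qualified, [A] would contain the fundamental circuit of [y] minus [y], so [y] would not
   raise the [M]-rank of [J :|: A], nor its [M']-rank by the quotient property. But that [M']-rank
   equals [rk M' J], which [y] does raise. *)
pose A := [set z in B | rk M' (z |: J) == rk M' J].
case: (pickP [pred z | [&& z \in B, (rk M' J < rk M' (z |: J))%N
              & y |: (B :\ z) \in bases M]]) => [z /and3P[? ? ?]|none].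
  by exists z.
have circ z : z \in B -> y |: (B :\ z) \in bases M -> z \in A.
  move=> zB zM; have := none z; rewrite /= zB zM andbT /= => /negbT/negP.
  by move/(rk_eqS (subsetU1 _ _)) => E; rewrite inE zB E eqxx.
have AB : A \subset B by apply/subsetP => z; rewrite inE => /andP[].
have E1 : rk M' (J :|: A) = rk M' J.
  by apply: rkU_stable => z; rewrite inE => /andP[_ /eqP].
have E2 := rkU1_stable (subsetUr J A) (rk_circuit BM AB yB circ).
have := quo _ _ (subsetU1 y (J :|: A)); rewrite E2 subnn E1 leqn0 subn_eq0.
rewrite leqNgt => /negP[]; apply: leq_trans lt _; apply: rkS.
by rewrite setUS // subsetUl.
Qed.

Lemma rk_quotient_refl n (M : matroid n) : rk_quotient M M.
Proof. by move=> A B _. Qed.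

Lemma rk_quotient_trans n (M1 M2 M3 : matroid n) :
  rk_quotient M1 M2 -> rk_quotient M2 M3 -> rk_quotient M1 M3.
Proof.
by move=> q12 q23 A B sAB; apply: leq_trans (q12 _ _ sAB) (q23 _ _ sAB).
Qed.

Lemma flag_rk_quotient n k (M : flag_matroid n k) (i j : 'I_k) :
  (i <= j)%N -> rk_quotient (M i) (M j).
Proof.
have [d] := ubnP (j - i)%N; elim: d j => // d IH j lt_d ij.
have [/val_inj->|ne] := eqVneq (i : nat) j; first exact: rk_quotient_refl.
have lt_ij : (i < j)%N by rewrite ltn_neqAle ne.
have ltk : (j.-1 < k)%N by apply: leq_ltn_trans (leq_pred j) (ltn_ord j).
apply: (@rk_quotient_trans _ _ (M (Ordinal ltk))).
  by apply: IH => /=; lia.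
by move=> A B sAB; apply: flag_quotient => //=; lia.
Qed.

Lemma symmetric_exchange n (M : matroid n) (B B' : {set 'I_n}) y :
    B \in bases M -> B' \in bases M -> y \in B' :\: B ->
  exists x, [/\ x \in B :\: B', y |: (B :\ x) \in bases M
              & x |: (B' :\ y) \in bases M].
Proof.
move=> BM B'M; rewrite inE => /andP[yB yB'].
have lt : (rk M (B' :\ y) < rk M (y |: (B' :\ y)))%N.
  by apply: rk_of_bases => //; rewrite setD1K.
have [x [xB lt' xM]] := quotient_exchange (@rk_quotient_refl _ M) BM yB lt.
exists x; split => //; last exact: bases_of_rk lt'.
rewrite inE xB andbT; apply/negP => xB'; move: lt'.
rewrite (_ : x |: _ = B' :\ y) ?ltnn //; apply/setUidPr.
by rewrite sub1set !inE xB' andbT; apply: contraNneq yB => <-.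
Qed.

End Matroids.

(** * Root vectors and convex cones *)

Definition rootv n (i j : 'I_n) : 'rV[int]_n := delta_mx 0 i - delta_mx 0 j.

Section Cones.
Variables (R : realFieldType) (n : nat).
Implicit Types (K X : set 'rV[R]_n) (x y u : 'rV[R]_n).

Lemma int_pointD (x y : 'rV[int]_n) :
  int_point R (x + y) = int_point R x + int_point R y.
Proof. exact: raddfD. Qed.

Lemma int_pointN (x : 'rV[int]_n) : int_point R (- x) = - int_point R x.
Proof. exact: raddfN. Qed.

Lemma int_point_inj : injective (@int_point R n).
Proof.
move=> x y /rowP e; apply/rowP => i.
by move: (e i); rewrite !mxE => /eqP; rewrite eqr_int => /eqP.
Qed.

Lemma rootvN (i j : 'I_n) : - rootv i j = rootv j i.
Proof. by rewrite opprB. Qed.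

Lemma rootvD (i j l : 'I_n) : rootv i j + rootv j l = rootv i l.
Proof. by rewrite addrA subrK. Qed.

Definition cone_closed K : Prop :=
  [/\ K 0, forall x y, K x -> K y -> K (x + y)
    & forall c x, 0 <= c -> K x -> K (c *: x)].

Lemma cone_closed_sum K (I : Type) (r : seq I) (F : I -> 'rV[R]_n) :
  cone_closed K -> (forall i, K (F i)) -> K (\sum_(i <- r) F i).
Proof. by move=> [K0 KD _] KF; elim/big_ind: _. Qed.

Lemma Cone_closed X : cone_closed (Cone X).
Proof.
split.
- exists 0%N, (fun _ => 0), (fun _ => 0).
  by split=> [[]|[]|] //; rewrite big_ord0.
- move=> x y [m [c [p [c0 pX ->]]]] [m' [c' [p' [c'0 p'X ->]]]].
  exists (m + m')%N,
    (fun i => match split i with inl j => c j | inr j => c' j end),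
    (fun i => match split i with inl j => p j | inr j => p' j end).
  split=> [i|i|]; [by case: split | by case: split |].
  rewrite big_split_ord; congr (_ + _); apply: eq_bigr => i _.
    by rewrite -/(unsplit (inl i)) unsplitK.
  by rewrite -/(unsplit (inr i)) unsplitK.
- move=> a x a0 [m [c [p [c0 pX ->]]]].
  exists m, (fun i => a * c i), p; split=> // [i|]; first exact: mulr_ge0.
  by rewrite scaler_sumr; apply: eq_bigr => i _; rewrite scalerA.
Qed.

Lemma Cone_gen X x : X x -> Cone X x.
Proof.
move=> Xx; exists 1%N, (fun _ => 1), (fun _ => x); split=> //.
by rewrite big_ord1 scale1r.
Qed.

Lemma Cone_min K X x : cone_closed K -> (forall y, X y -> K y) ->
  Cone X x -> K x.
Proof.
move=> cK XK [m [c [p [c0 pX ->]]]]; apply: cone_closed_sum => // i.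
by case: cK => _ _ KZ; apply: KZ => //; apply: XK.
Qed.

Lemma dotDr u x y : dot u (x + y) = dot u x + dot u y.
Proof.
by rewrite -big_split; apply: eq_bigr => i _; rewrite mxE mulrDr.
Qed.

Lemma dotZr u c x : dot u (c *: x) = c * dot u x.
Proof.
by rewrite mulr_sumr; apply: eq_bigr => i _; rewrite mxE mulrCA.
Qed.

Lemma dotNr u x : dot u (- x) = - dot u x.
Proof. by rewrite -scaleN1r dotZr mulN1r. Qed.

Lemma dotBr u x y : dot u (x - y) = dot u x - dot u y.
Proof. by rewrite dotDr dotNr. Qed.

Lemma dot0r u : dot u 0 = 0.
Proof. by rewrite -[0](scale0r 0) dotZr mul0r. Qed.

Lemma dot_root u i j : dot u (int_point R (rootv i j)) = u 0 i - u 0 j.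
Proof.
have D l : dot u (int_point R (delta_mx 0 l)) = u 0 l.
  rewrite /dot (bigD1 l) //= big1 => [|i' ne]; rewrite !mxE !eqxx.
    by rewrite mulr1 addr0.
  by rewrite (negPf ne) mulr0.
by rewrite int_pointD int_pointN dotBr !D.
Qed.

Lemma Conv_gen X x : X x -> Conv X x.
Proof.
move=> Xx; exists 1%N, (fun _ => 1), (fun _ => x).
by split=> //; rewrite big_ord1 ?scale1r.
Qed.

Lemma evec_exchange (A : {set 'I_n}) (x y : 'I_n) : x \in A -> y \notin A ->
  evec R (y |: (A :\ x)) = evec R A + int_point R (rootv y x).
Proof.
move=> xA yA; apply/rowP => i; rewrite !mxE !inE !eqxx /=.
have [->|iy] := eqVneq i y.
  have /negPf-> : y != x by apply: contraNneq yA => ->.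
  by rewrite (negPf yA) subr0 add0r.
have [->|ix] := eqVneq i x; first by rewrite xA sub0r rmorphN1 addrN.
by rewrite /= subrr addr0.
Qed.

End Cones.

(** * Cones of the flag matroid polytope at its bases *)

Section FlagCones.
Import fintype boot.finset.
Variables (R : realFieldType) (n k : nat).

(** Each symmetric exchange moves [A'] one element closer to [A], and its other half shows that the
    root split off is an exchange root at [A]. *)
Lemma evec_sub_cone (M : matroid n) (K : set 'rV[R]_n) (A A' : {set 'I_n}) :
    cone_closed K -> A \in bases M -> A' \in bases M ->
    (forall x y, x \in A -> y \notin A -> y |: (A :\ x) \in bases M ->
       K (int_point R (rootv y x))) ->
  K (evec R A' - evec R A).
Proof.
move=> cK AM + exK; have [d] := ubnP #|A' :\: A|.
elim: d A' => // d IH A'; rewrite ltnS => le_d A'M.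
have [A'A|[y yA'A]] := set_0Vmem (A' :\: A).
  have -> : A' = A.
    apply/eqP; rewrite eqEcard (card_bases A'M AM) leqnn andbT.
    by rewrite -setD_eq0 A'A.
  by rewrite subrr; case: cK.
have [x [xAA' yM xM]] := symmetric_exchange AM A'M yA'A.
move: yA'A xAA'; rewrite !inE => /andP[yA yA'] /andP[xA' xA].
have : K (evec R (x |: (A' :\ y)) - evec R A).
  apply: IH => //; apply: leq_trans le_d; apply: proper_card.
  apply/properP; split.
    apply/subsetP => z; rewrite !inE => /andP[zA /orP[/eqP zx|/andP[_ ->]]].
      by rewrite zx xA in zA.
    by rewrite zA.
  by exists y; rewrite !inE ?yA ?yA' //= eqxx orbF; apply: contraNneq xA' => <-.
rewrite (evec_exchange _ yA' xA') => Kd.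
have [_ KD _] := cK; have := KD _ _ Kd (exK _ _ xA yA yM).
by rewrite -[rootv x y]rootvN int_pointN addrAC subrK.
Qed.

Variable M : flag_matroid n k.
Implicit Types (B : flag n k).

Lemma basis_cone_closed B : cone_closed (basis_cone R M B).
Proof. exact: Cone_closed. Qed.

Lemma basis_cone_gen B B' : flag_basis M B' ->
  basis_cone R M B (evec_flag R B' - evec_flag R B).
Proof.
move=> B'M; apply: Cone_gen; exists (evec_flag R B') => //.
by apply: Conv_gen; exists B'.
Qed.

Lemma basis_cone_min B (K : set 'rV[R]_n) x : cone_closed K ->
    (forall B', flag_basis M B' -> K (evec_flag R B' - evec_flag R B)) ->
  basis_cone R M B x -> K x.
Proof.
move=> cK KB; apply: Cone_min => // _ [q [m [c [p [c0 c1 pM ->]]]] ->].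
rewrite -[evec_flag R B]scale1r -c1 scaler_suml -sumrB.
apply: cone_closed_sum => // i; rewrite -scalerBr.
by have [_ _ KZ] := cK; apply: KZ => //; have [B' /KB ? ->] := pM i.
Qed.

Definition flag_exchange B j (x y : 'I_n) : Prop :=
  [/\ x \in B j, y \notin B j & y |: (B j :\ x) \in bases (M j)].

Lemma flag_exchange_split B i j x y : flag_basis M B ->
    x \in B i -> y \notin B i -> flag_exchange B j x y ->
    y |: (B i :\ x) \notin bases (M i) ->
  exists z i' j', [/\ z \notin B i', z \in B j',
    flag_exchange B i' x z & flag_exchange B j' z y].
Proof.
move=> [chB BM] xi yi [xj yj ex_j] not_i.
have [le_ij|/ltnW le_ji] := leqP i j.
(* The exchange is applied to the modified basis [y |: (B j :\ x)]: putting [x] back in place of [z]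
   yields [y |: (B j :\ z)], and the rank gain in [M i] yields [z |: (B i :\ x)]. *)
- have lt : (rk (M i) (B i :\ x) < rk (M i) (x |: (B i :\ x)))%N.
    by apply: rk_of_bases => //; rewrite setD1K.
  have xB' : x \notin y |: (B j :\ x).
    by rewrite !inE eqxx orbF; apply: contraNneq yi => <-.
  have [z [zB' ltz zM]] :=
    quotient_exchange (flag_rk_quotient M le_ij) ex_j xB' lt.
  have zI := bases_of_rk (BM i) xi ltz.
  have zy : z != y by apply: contraNneq not_i => <-.
  move: zB'; rewrite !inE (negPf zy) /= => /andP[zx zj].
  have zi : z \notin B i.
    apply/negP => zi; move: ltz; rewrite (_ : z |: _ = B i :\ x) ?ltnn //.
    by apply/setUidPr; rewrite sub1set !inE zx.
  exists z, i, j; split => //; split => //.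
  rewrite (_ : _ |: _ = x |: ((y |: (B j :\ x)) :\ z)) //.
  apply/setP => t; rewrite !inE; have [->|tx] /= := eqVneq t x.
    by rewrite xj (eq_sym x z) zx orbT.
  by have [->|] //= := eqVneq t y; rewrite eq_sym zy.
(* Here [M j] is the quotient: [y] replaces some [z] at level [i], and this [z] can replace [x] at
   level [j]. *)
have lt : (rk (M j) (B j :\ x) < rk (M j) (y |: (B j :\ x)))%N.
  exact: rk_of_bases.
have [z [zi ltz zM]] :=
  quotient_exchange (flag_rk_quotient M le_ji) (BM i) yi lt.
have zx : z != x by apply: contraNneq not_i => <-.
have zj : z \notin B j.
  apply/negP => zj; move: ltz; rewrite (_ : z |: _ = B j :\ x) ?ltnn //.
  by apply/setUidPr; rewrite sub1set !inE zx.
exists z, j, i; split => //; split => //; exact: bases_of_rk ltz.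
Qed.

(* If the exchange of [x] for [y] fails at some level it factors through a
   third element present at fewer levels than [x] and more than [y]; otherwise
   exchanging at all levels at once gives a flag whose difference with [B] is a
   multiple of the rootv. *)
Lemma flag_exchange_cone B j x y : flag_basis M B -> flag_exchange B j x y ->
  basis_cone R M B (int_point R (rootv y x)).
Proof.
move=> BM; have [chB BMi] := BM.
pose gap x y := [set l | (x \in B l) && (y \notin B l)].
have [d] := ubnP #|gap x y|; elim: d j x y => // d IH j x y.
rewrite ltnS => le_d ex_j; have [xj yj _] := ex_j.
have [bad|good] := pselect (exists2 i, i \in gap x y &
  y |: (B i :\ x) \notin bases (M i)).
- have [i] := bad; rewrite inE => /andP[xi yi] not_i.
  have [z [i' [j' [zi' zj' ex1 ex2]]]] := flag_exchange_split BM xi yi ex_j not_i.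
  have [xi' _ _] := ex1; have [_ yj' _] := ex2.
  (* Each element occupies a final segment of levels, so [gap x y] measures how much earlier [x]
     enters than [y]; [z] enters strictly between them. *)
  have up a (l l' : 'I_k) : a \in B l -> (l <= l')%N -> a \in B l'.
    by move=> al /chB /subsetP; apply.
  have cmp a (l l' : 'I_k) : a \in B l -> a \notin B l' -> (l' <= l)%N.
    move=> al; apply: contraNT; rewrite -ltnNge => /ltnW; exact: up.
  have le_ij := cmp _ _ _ zj' zi'.
  have lt1 : (#|gap x z| < d)%N.
    apply: leq_trans le_d; apply: proper_card; apply/properP; split.
      apply/subsetP => l; rewrite !inE => /andP[-> zl].
      by apply: contra yj' => yl; apply: (up _ _ _ yl); apply: (cmp _ _ _ zj' zl).
    by exists j'; rewrite !inE ?zj' ?andbF // yj' (up _ _ _ xi' le_ij).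
  have lt2 : (#|gap z y| < d)%N.
    apply: leq_trans le_d; apply: proper_card; apply/properP; split.
      apply/subsetP => l; rewrite !inE => /andP[zl ->].
      by rewrite (up _ _ _ xi' (cmp _ _ _ zl zi')).
    exists i'; rewrite !inE ?(negPf zi') // xi'.
    by apply: contra yj' => yi'; apply: (up _ _ _ yi' le_ij).
  rewrite -(rootvD y z x) int_pointD; have [_ KD _] := basis_cone_closed B.
  by apply: KD; [apply: IH lt2 ex2 | apply: IH lt1 ex1].
pose B' : flag n k := [ffun l => if l \in gap x y then y |: (B l :\ x) else B l].
have B'M : flag_basis M B'.
  split=> [l l' ll'|l]; rewrite !ffunE; last first.
    have [lg|_] := boolP (l \in gap x y); last exact: BMi.
    by apply/negPn/negP => not_l; apply: good; exists l.
  (* The mixed cases need care: if only [l] is in the gap, [y] already lies in [B l']; if only [l']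
     is, [x] does not yet lie in [B l]. *)
  have /subsetP sB := chB _ _ ll'.
  have sx := sB x; have sy := sB y.
  apply/subsetP => z; rewrite ![_ \in gap x y]inE.
  case: ifP => c1; case: ifP => c2; last exact: sB.
  - by rewrite !inE => /orP[->//|/andP[-> /sB->]]; rewrite orbT.
  - move/andP: c1 => [/sx xl' _]; move: c2; rewrite xl' => /negbFE yl'.
    by rewrite !inE => /orP[/eqP->//|/andP[_ /sB]].
  - move/andP: c2 => [_ yl'].
    have /negPf yl : y \notin B l by apply: contra yl' => /sy.
    move: c1; rewrite yl andbT => /negbT xl zl; rewrite !inE (sB _ zl) andbT.
    by rewrite (contraNneq _ xl) ?orbT // => <-.
have E : evec_flag R B' - evec_flag R B =
    #|gap x y|%:R *: int_point R (rootv y x).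
  rewrite -sumrB -sum1_card natr_sum scaler_suml [RHS]big_mkcond /=.
  apply: eq_bigr => l _; rewrite ffunE.
  have [|_] := boolP (l \in gap x y); last by rewrite subrr.
  by rewrite inE => /andP[xl yl]; rewrite evec_exchange // addrC addKr scale1r.
have gap0 : #|gap x y|%:R != 0 :> R.
  by rewrite pnatr_eq0 -lt0n; apply/card_gt0P; exists j; rewrite inE xj.
rewrite -[int_point R _]scale1r -(mulVf gap0) -scalerA -E.
have [_ _ KZ] := basis_cone_closed B; apply: KZ; last exact: basis_cone_gen.
by rewrite invr_ge0 ler0n.
Qed.

(** The difference of two flags splits over the levels, and at each level [evec_sub_cone] asks only
    for exchanges of that one constituent. *)
Lemma basis_cone_exchange_min B (K : set 'rV[R]_n) x :
    flag_basis M B -> cone_closed K ->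
    (forall j a b, flag_exchange B j a b -> K (int_point R (rootv b a))) ->
  basis_cone R M B x -> K x.
Proof.
move=> [_ BM] cK exK; apply: basis_cone_min => // B' [_ B'M].
rewrite -sumrB; apply: cone_closed_sum => // j.
by apply: evec_sub_cone => // a b aB bB ab; apply: (exK j).
Qed.

Lemma dot_evec_flag B B' :
  dot (evec_flag R B) (evec_flag R B') = (\sum_i \sum_j #|B i :&: B' j|)%:R.
Proof.
rewrite natr_sum /evec_flag.
transitivity (\sum_(l < n) \sum_i \sum_j
    ((l \in B i)%:R * (l \in B' j)%:R : R)).
  apply: eq_bigr => l _; rewrite !summxE mulr_suml; apply: eq_bigr => i _.
  by rewrite mulr_sumr; apply: eq_bigr => j _; rewrite !mxE.
rewrite exchange_big; apply: eq_bigr => i _; rewrite exchange_big natr_sum.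
apply: eq_bigr => j _; rewrite -sum1_card natr_sum [RHS]big_mkcond.
by apply: eq_bigr => l _; rewrite inE -natrM mulnb; case: (_ && _).
Qed.

(** By the chain condition and equality of basis sizes, [#|B i :&: B j|] is the smaller of the two
    sizes, hence bounds [#|B i :&: B' j|]; the bound is strict on the diagonal where [B] and [B']
    differ. *)
Lemma dot_evec_flag_lt B B' : flag_basis M B -> flag_basis M B' -> B' <> B ->
  dot (evec_flag R B) (evec_flag R B') < dot (evec_flag R B) (evec_flag R B).
Proof.
move=> [chB BM] [chB' B'M] ne; rewrite !dot_evec_flag ltr_nat.
have le i j : (#|B i :&: B' j| <= #|B i :&: B j|)%N.
  have [/chB sB|/ltnW /chB sB] := leqP i j.
    by rewrite (setIidPl sB) subset_leq_card // subsetIl.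
  rewrite (setIidPr sB) (card_bases (BM j) (B'M j)).
  by rewrite subset_leq_card // subsetIr.
have [i neB] : exists i, B i != B' i.
  apply/existsP; rewrite -negb_forall; apply/negP => /forallP e.
  by apply: ne; apply/ffunP => i; rewrite (eqP (e i)).
rewrite (bigD1 i) //= [X in (_ < X)%N](bigD1 i) //= -addSn leq_add //; last first.
  by apply: leq_sum => i' _; apply: leq_sum => j _.
rewrite (bigD1 i) //= [X in (_ < X)%N](bigD1 i) //= -addSn leq_add //; last first.
  exact: leq_sum.
rewrite setIid ltn_neqAle subset_leq_card ?subsetIl // andbT.
apply: contraNneq neB => e; rewrite eqEcard (card_bases (B'M i) (BM i)) leqnn andbT.
by apply/setIidPl/eqP; rewrite eqEcard subsetIl e leqnn.
Qed.

(** Pointedness of the cone, in the quantitative form that lets [evec_flag R B] break ties in the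
    order on exponents. *)
Lemma basis_cone_dot_lt B x : flag_basis M B -> basis_cone R M B x -> x != 0 ->
  dot (evec_flag R B) x < 0.
Proof.
move=> BM Cx x0.
suff [e|//] : x = 0 \/ dot (evec_flag R B) x < 0 by rewrite e eqxx in x0.
pose K : set 'rV[R]_n := fun y => y = 0 \/ dot (evec_flag R B) y < 0.
apply: (@basis_cone_min _ K) Cx; last first.
  move=> B' B'M; have [->|ne] := pselect (B' = B); [left|right].
    by rewrite subrr.
  by rewrite dotBr subr_lt0 dot_evec_flag_lt.
split; first by left.
- move=> y z [->|ly]; rewrite ?add0r // => -[->|lz]; first by right; rewrite addr0.
  by right; rewrite dotDr -[0]addr0 ltrD.
- move=> c y c0 [->|lx]; first by left; rewrite scaler0.
  move: c0; rewrite le_eqVlt => /orP[/eqP<-|c0]; first by left; rewrite scale0r.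
  by right; rewrite dotZr pmulr_rlt0.
Qed.

End FlagCones.

(** * Laurent polynomials as lists of terms, and the series they sum *)

Section LaurentTerms.
Variable n : nat.
Notation lattice := 'rV[int]_n.
(* A Laurent polynomial as an unreduced list of terms (coefficient, exponent). *)
Notation terms := (seq (rat * lattice)).
Implicit Types (T U : terms) (s : lattice -> rat) (x y r : lattice).

Definition terms_ratfun T : ratfun n := \sum_(t <- T) ratC t.1 * tmon t.2.

Definition terms_act T s : lattice -> rat :=
  fun x => \sum_(t <- T) t.1 * s (x - t.2).

Definition terms_coef T : lattice -> rat :=
  fun x => \sum_(t <- T) t.1 * (x == t.2)%:R.

Definition terms_mul T U : terms :=
  [seq (t.1 * u.1, t.2 + u.2) | t <- T, u <- U].

Lemma tmon0 : tmon 0 = 1 :> ratfun n.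
Proof. by rewrite /tmon big1 // => i _; rewrite mxE. Qed.

Lemma ratC1 : ratC 1 = 1 :> ratfun n.
Proof. by rewrite /ratC mpolyC1 tofrac1. Qed.

Lemma ratCD a b : ratC (a + b) = ratC a + ratC b :> ratfun n.
Proof. by rewrite /ratC mpolyCD tofracD. Qed.

Lemma ratCN a : ratC (- a) = - ratC a :> ratfun n.
Proof. by rewrite /ratC mpolyCN tofracN. Qed.

Lemma terms_ratfun_cat T U :
  terms_ratfun (T ++ U) = terms_ratfun T + terms_ratfun U.
Proof. exact: big_cat. Qed.

Lemma terms_coef_cat T U x :
  terms_coef (T ++ U) x = terms_coef T x + terms_coef U x.
Proof. exact: big_cat. Qed.

Lemma terms_ratfun_mul T U :
  terms_ratfun (terms_mul T U) = terms_ratfun T * terms_ratfun U.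
Proof.
rewrite /terms_ratfun big_allpairs_dep mulr_suml; apply: eq_bigr => t _.
by rewrite mulr_sumr; apply: eq_bigr => u _; rewrite ratCM tmonD mulrACA.
Qed.

Lemma terms_act_mul T U s x :
  terms_act (terms_mul T U) s x = terms_act T (terms_act U s) x.
Proof.
rewrite /terms_act big_allpairs_dep; apply: eq_bigr => t _.
by rewrite mulr_sumr; apply: eq_bigr => u _; rewrite mulrA opprD addrA.
Qed.

Lemma terms_coefE T x : terms_coef T x = terms_act T (fun y => (y == 0)%:R) x.
Proof. by apply: eq_bigr => t _; rewrite subr_eq0. Qed.

Lemma terms_coef_mul T U x :
  terms_coef (terms_mul T U) x = terms_act T (terms_coef U) x.
Proof.
rewrite terms_coefE terms_act_mul; apply: eq_bigr => t _.
by rewrite terms_coefE.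
Qed.

Lemma terms_actC T U s x :
  terms_act T (terms_act U s) x = terms_act U (terms_act T s) x.
Proof.
rewrite /terms_act; under eq_bigr do rewrite mulr_sumr.
under [RHS]eq_bigr do rewrite mulr_sumr.
rewrite exchange_big; apply: eq_bigr => t _; apply: eq_bigr => u _.
by rewrite mulrCA addrAC.
Qed.

Lemma terms_actD T s s' x :
  terms_act T (fun y => s y + s' y) x = terms_act T s x + terms_act T s' x.
Proof. by rewrite -big_split; apply: eq_bigr => t _; rewrite mulrDr. Qed.

Lemma eq_terms_act T s s' x : s =1 s' -> terms_act T s x = terms_act T s' x.
Proof. by move=> e; apply: eq_bigr => t _; rewrite e. Qed.

Lemma nonneg_shift (L : seq lattice) :
  exists N : nat, forall x i, x \in L -> 0 <= x 0 i + N%:Z.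
Proof.
elim: L => [|x L [N HN]]; first by exists 0%N.
exists (N + \sum_(i < n) `|x 0%R i|)%N => y i; rewrite inE => /orP[/eqP->|yL].
  by rewrite (bigD1 i) //=; lia.
by have := HN y i yL; lia.
Qed.

Lemma tmon_nonneg x : (forall i, 0 <= x 0 i) ->
  tmon x = tofrac 'X_[[multinom `|x 0%R i|%N | i < n]].
Proof.
move=> x0; rewrite mpolyXE_id rmorph_prod /=; apply: eq_bigr => i _.
by rewrite mnmE rmorphXn /= exprnP gez0_abs.
Qed.

(** Multiplying by a monomial with large exponents turns all terms into polynomial ones, whose
    coefficients can be compared. *)
Lemma terms_ratfun_inj T y : terms_ratfun T = 0 -> terms_coef T y = 0.
Proof.
have [N HN] := nonneg_shift (y :: map snd T).
pose mon x := [multinom `|(x + const_mx N%:Z)%R 0%R i|%N | i < n].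
have H x i : x \in y :: map snd T -> 0 <= (x + const_mx N%:Z) 0 i.
  by move=> xL; rewrite !mxE HN.
have E : terms_ratfun T * tmon (const_mx N%:Z) =
    tofrac (\sum_(t <- T) t.1 *: 'X_[mon t.2]).
  rewrite mulr_suml rmorph_sum; apply: eq_big_seq => t tT.
  rewrite -mulrA -tmonD tmon_nonneg => [|i]; last first.
    by apply: H; rewrite inE map_f ?orbT.
  by rewrite -mul_mpolyC rmorphM.
move=> T0; move: E; rewrite T0 mul0r => /esym/eqP.
rewrite tofrac_eq0 => /eqP /(congr1 (mcoeff (mon y))).
rewrite mcoeff0 raddf_sum => <-; apply: eq_big_seq => t tT.
rewrite /= mcoeffZ mcoeffX; suff -> : (mon t.2 == mon y) = (y == t.2) by [].
rewrite eq_sym.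
apply/eqP/eqP => [/mnmP e|->//]; apply/rowP => i; move: (e i).
have := H t.2 i; rewrite inE map_f ?orbT // => /(_ isT).
have := H y i; rewrite inE eqxx !mnmE !mxE => /(_ isT).
by move=> y0 t0 /(congr1 Posz); rewrite !gez0_abs // => /addIr.
Qed.

(** A form of [represents] on unreduced lists, so that sums and products need no bookkeeping of
    supports or cancellation. *)
Definition finite_series f s : Prop :=
  exists T U, [/\ terms_ratfun T != 0, terms_act T s =1 terms_coef U
                & f = terms_ratfun U / terms_ratfun T].

Definition terms_laurent T : laurent n :=
  [fsfun x in seq_fset tt (map snd T) => terms_coef T x].

Lemma terms_laurentE T : terms_laurent T =1 terms_coef T.
Proof.
move=> x; rewrite fsfunE seq_fsetE; case: ifP => // /negbT xT.
rewrite /terms_coef big1_seq // => t /andP[_ tT].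
by rewrite (negPf (_ : x != t.2)) ?mulr0 //; apply: contraNneq xT => ->;
   exact: map_f.
Qed.

Lemma finsupp_terms_laurent T :
  {subset finsupp (terms_laurent T) <= undup (map snd T)}.
Proof.
move=> x; rewrite mem_finsupp fsfunE seq_fsetE mem_undup.
by case: ifP => //; rewrite eqxx.
Qed.

(** Collecting like terms preserves any sum additive in the coefficient; it is applied to the
    rational function and to the action on series. *)
Lemma terms_big (V : zmodType) T (F : rat -> lattice -> V) :
    (forall a b x, F (a + b) x = F a x + F b x) ->
  \sum_(x <- undup (map snd T)) F (terms_coef T x) x = \sum_(t <- T) F t.1 t.2.
Proof.
move=> FD; have F0 x : F 0 x = 0.
  by apply: (addrI (F 0 x)); rewrite -FD !addr0.
have Fsum x : F (terms_coef T x) x = \sum_(t <- T) F (t.1 * (x == t.2)%:R) x.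
  by rewrite /terms_coef; elim/big_rec2: _ => // t u a _ <-; rewrite FD.
under eq_bigr do rewrite Fsum.
rewrite exchange_big; apply: eq_big_seq => t tT /=.
rewrite (bigD1_seq t.2) ?undup_uniq ?mem_undup ?map_f //= eqxx mulr1.
by rewrite big1 ?addr0 // => x ne; rewrite (negPf ne) mulr0.
Qed.

Lemma terms_laurent_ratfun T : laurent_ratfun (terms_laurent T) = terms_ratfun T.
Proof.
rewrite (laurent_ratfun_seq (undup_uniq _) (@finsupp_terms_laurent T)).
under eq_bigr do rewrite terms_laurentE.
apply: (@terms_big _ T (fun a x => ratC a * tmon x)) => a b x.
by rewrite ratCD mulrDl.
Qed.

Lemma terms_laurent_mul T s x :
  laurent_mul_series (terms_laurent T) s x = terms_act T s x.
Proof.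
rewrite /terms_act -(@terms_big _ T (fun a y => a * s (x - y))); last first.
  by move=> a b y; rewrite mulrDl.
rewrite /laurent_mul_series (eq_bigr (fun y => terms_coef T y * s (x - y))).
  rewrite [RHS](bigID (mem (finsupp (terms_laurent T)))) /= [X in _ + X]big1.
    rewrite addr0 -[RHS]big_filter; apply: perm_big; apply: uniq_perm.
    - exact: fset_uniq.
    - by rewrite filter_uniq ?undup_uniq.
    move=> y; rewrite mem_filter.
    by have [/finsupp_terms_laurent->|//] := boolP (y \in finsupp _).
  by move=> y; rewrite mem_finsupp negbK terms_laurentE => /eqP->; rewrite mul0r.
by move=> y _; rewrite terms_laurentE.
Qed.

Lemma represents_finite_series f s : finite_series f s -> represents f s.
Proof.
move=> [T [U [T0 e ->]]]; exists (terms_laurent T), (terms_laurent U).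
rewrite !terms_laurent_ratfun; split=> // x.
by rewrite terms_laurent_mul e terms_laurentE.
Qed.

Lemma eq_finite_series f s s' : s =1 s' -> finite_series f s -> finite_series f s'.
Proof.
move=> e [T [U [T0 eU ->]]]; exists T, U; split=> // x.
by rewrite -eU; apply: eq_terms_act => y; rewrite e.
Qed.

Lemma finite_seriesD f g s s' : finite_series f s -> finite_series g s' ->
  finite_series (f + g) (fun x => s x + s' x).
Proof.
move=> [T [U [T0 e ->]]] [T' [U' [T'0 e' ->]]].
exists (terms_mul T T'), (terms_mul T' U ++ terms_mul T U').
split.
- rewrite terms_ratfun_mul; exact: mulf_neq0 T0 T'0.
- move=> x; rewrite terms_act_mul terms_coef_cat !terms_coef_mul.
  rewrite (eq_terms_act T x (terms_actD T' s s')) (terms_actD T).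
  rewrite (terms_actC T T'); congr (_ + _); exact: eq_terms_act.
- rewrite (addf_div _ _ T0 T'0) terms_ratfun_cat !terms_ratfun_mul.
  by rewrite ![_ * terms_ratfun T']mulrC [_ * terms_ratfun T]mulrC.
Qed.

Definition one_minus r : terms := [:: (1, 0); (-1, r)].

Lemma terms_ratfun_one_minus r : terms_ratfun (one_minus r) = 1 - tmon r.
Proof.
by rewrite /terms_ratfun big_cons big_seq1 /= ratCN ratC1 tmon0 mulr1 mulN1r.
Qed.

Lemma terms_act_one_minus r s x : terms_act (one_minus r) s x = s x - s (x - r).
Proof. by rewrite /terms_act big_cons big_seq1 /= subr0 mul1r mulN1r. Qed.

Lemma one_minus_neq0 r : r != 0 -> 1 - tmon r != 0 :> ratfun n.
Proof.
move=> r0; rewrite -terms_ratfun_one_minus; apply/eqP => /terms_ratfun_inj e.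
move: (e 0); rewrite terms_coefE terms_act_one_minus eqxx sub0r oppr_eq0.
by rewrite (negPf r0) subr0 => /eqP; rewrite oner_eq0.
Qed.

(** [1 - tmon r] annihilates a series invariant under translation by [r]; this is why a cone
    containing a line has Hilbert series 0. *)
Lemma finite_series_periodic r s : r != 0 -> (forall x, s (x - r) = s x) ->
  finite_series 0 s.
Proof.
move=> r0 e; exists (one_minus r), [::]; split=> [|x|].
- rewrite terms_ratfun_one_minus; exact: one_minus_neq0.
- by rewrite terms_act_one_minus e subrr /terms_coef big_nil.
- by rewrite /terms_ratfun big_nil mul0r.
Qed.

Lemma finite_series_geometric r f s s' : r != 0 -> finite_series f s ->
    (forall x, s' x - s' (x - r) = s x) -> finite_series (f / (1 - tmon r)) s'.
Proof.
move=> r0 [T [U [T0 e ->]]] e'; exists (terms_mul T (one_minus r)), U.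
split=> [|x|]; rewrite ?terms_ratfun_mul ?terms_ratfun_one_minus.
- exact: mulf_neq0 T0 (one_minus_neq0 r0).
- rewrite terms_act_mul -e; apply: eq_terms_act => y.
  by rewrite terms_act_one_minus.
- by rewrite invfM mulrA.
Qed.

Lemma finite_series_delta : finite_series 1 (fun x => (x == 0)%:R).
Proof.
exists [:: (1, 0)], [:: (1, 0)]; rewrite /terms_ratfun big_seq1 ratC1 tmon0 mul1r.
by split=> [|x|]; rewrite ?oner_eq0 // ?divr1 // terms_coefE.
Qed.

End LaurentTerms.

(** * Leading terms and limits for a total order on exponents compatible with addition *)

Section LeadingTerm.
Variables (n : nat) (P : 'rV[int]_n -> Prop).
Hypothesis P_add : forall x y, P x -> P y -> P (x + y).
Hypothesis P_irrefl : ~ P 0.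
Hypothesis P_total : forall x, x != 0 -> P x \/ P (- x).
Implicit Types (f g h : ratfun n) (x y z : 'rV[int]_n) (a b c d : rat).

(* [P (y - x)] orders the exponents by [x < y]. *)
Definition leading f y b : Prop :=
  exists2 T, forall t, t \in T -> P (y - t.2)
           & f = ratC b * tmon y + terms_ratfun T.

Lemma leading_term b y : leading (ratC b * tmon y) y b.
Proof. by exists [::] => //; rewrite /terms_ratfun big_nil addr0. Qed.

(** The coefficient 0 is allowed in [leading], and then says only that all exponents lie below
    [z]. *)
Lemma leading_lt f y z b : leading f y b -> P (z - y) -> leading f z 0.
Proof.
move=> [T HT ->] zy; exists ((b, y) :: T).
  move=> t; rewrite inE => /orP[/eqP->//|/HT Pt].
  by rewrite -(subrK y z) -addrA; apply: P_add.
by rewrite ratC0 mul0r add0r /terms_ratfun big_cons.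
Qed.

Lemma leadingD f g y b d : leading f y b -> leading g y d ->
  leading (f + g) y (b + d).
Proof.
move=> [T HT ->] [U HU ->]; exists (T ++ U).
  by move=> t; rewrite mem_cat => /orP[/HT|/HU].
by rewrite terms_ratfun_cat ratCD mulrDl addrACA.
Qed.

Lemma leadingM f g y z b d : leading f y b -> leading g z d ->
  leading (f * g) (y + z) (b * d).
Proof.
move=> [T HT ->] [U HU ->].
exists (terms_mul [:: (b, y)] U ++ terms_mul T ((d, z) :: U)).
  move=> t; rewrite mem_cat => /orP[] /allpairsP[[p q] /= [pI qI ->]] /=.
    rewrite inE in pI; rewrite (eqP pI) opprD addrACA subrr add0r; exact: HU.
  rewrite opprD addrACA; have Pp := HT _ pI.
  move: qI; rewrite inE => /orP[/eqP->|/HU Pq]; last exact: P_add.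
  by rewrite subrr addr0.
rewrite terms_ratfun_cat !terms_ratfun_mul ratCM tmonD.
have -> : terms_ratfun [:: (b, y)] = ratC b * tmon y.
  by rewrite /terms_ratfun big_seq1.
rewrite [terms_ratfun (_ :: _)]/terms_ratfun big_cons -/(terms_ratfun U) /=.
by rewrite mulrACA !mulrDl !mulrDr !addrA.
Qed.

(** Subtracting the two expansions gives a vanishing list of terms whose coefficient at [y] is
    [b - d]: irreflexivity keeps [y] out of both tails. *)
Lemma leading_uniq f y b d : leading f y b -> leading f y d -> b = d.
Proof.
move=> [T HT eT] [U HU eU].
have coef0 (V : seq (rat * 'rV[int]_n)) :
    (forall t, t \in V -> P (y - t.2)) -> terms_coef V y = 0.
  move=> HV; rewrite /terms_coef big1_seq // => t /andP[_ /HV].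
  by case: eqP => [<-|_]; rewrite ?mulr0 // subrr.
have : terms_ratfun (((b, y) :: T) ++ terms_mul [:: (-1, 0)] ((d, y) :: U)) = 0.
  rewrite terms_ratfun_cat terms_ratfun_mul.
  rewrite [terms_ratfun ((b, y) :: T)]/terms_ratfun big_cons -/(terms_ratfun T).
  rewrite [terms_ratfun ((d, y) :: U)]/terms_ratfun big_cons -/(terms_ratfun U).
  rewrite /= -eT -eU /terms_ratfun big_seq1 /= ratCN ratC1 tmon0 mulr1 mulN1r.
  by rewrite subrr.
move=> /(terms_ratfun_inj y); rewrite terms_coef_cat terms_coef_mul.
rewrite /terms_act big_seq1 /= subr0 mulN1r /terms_coef !big_cons /= eqxx !mulr1.
rewrite -!/(terms_coef _ _) !coef0 // !addr0.
by move/eqP; rewrite subr_eq0 => /eqP.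
Qed.

(* [f] expands as a series in descending exponents with constant term [b] and
   all other exponents below 0. *)
Definition has_limit f b : Prop :=
  exists g h z d, [/\ leading h z d, d != 0, leading g z (b * d) & f = g / h].

Lemma leading_neq0 h z d : leading h z d -> d != 0 -> h != 0.
Proof.
move=> lh; apply: contraNneq => h0; apply/eqP/(leading_uniq lh).
by exists [::] => //; rewrite h0 /terms_ratfun big_nil ratC0 mul0r addr0.
Qed.

Lemma has_limitD f g b d : has_limit f b -> has_limit g d ->
  has_limit (f + g) (b + d).
Proof.
move=> [p [q [z [c [lq c0 lp ->]]]]] [p' [q' [z' [c' [lq' c'0 lp' ->]]]]].
exists (p * q' + p' * q), (q * q'), (z + z'), (c * c'); split.
- exact: leadingM.
- exact: mulf_neq0 c0 c'0.
- rewrite mulrDl; apply: leadingD.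
    by rewrite mulrA; apply: leadingM.
  by rewrite addrC [c * c']mulrC mulrA; apply: leadingM.
- by rewrite addf_div // ?(leading_neq0 lq) ?(leading_neq0 lq').
Qed.

Lemma has_limitM f g b d : has_limit f b -> has_limit g d ->
  has_limit (f * g) (b * d).
Proof.
move=> [p [q [z [c [lq c0 lp ->]]]]] [p' [q' [z' [c' [lq' c'0 lp' ->]]]]].
exists (p * p'), (q * q'), (z + z'), (c * c'); split.
- exact: leadingM.
- exact: mulf_neq0 c0 c'0.
- by rewrite mulrACA; apply: leadingM.
- by rewrite mulf_div.
Qed.

Lemma leading1 : leading 1 0 1.
Proof. by rewrite -[X in leading X](mulr1 1) -{1}ratC1 -tmon0; apply: leading_term. Qed.

Lemma leading_limit f b : leading f 0 b -> has_limit f b.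
Proof.
move=> lf; exists f, 1, 0, 1; rewrite mulr1 divr1 oner_eq0; split=> //.
exact: leading1.
Qed.

Lemma has_limitC a : has_limit (ratC a) a.
Proof.
by apply: leading_limit; rewrite -[ratC a]mulr1 -tmon0; apply: leading_term.
Qed.

Lemma has_limit_tmon x : P (- x) -> has_limit (tmon x) 0.
Proof.
move=> Px; apply: leading_limit.
have lx : leading (tmon x) x 1.
  by rewrite -[tmon x]mul1r -ratC1; apply: leading_term.
by apply: leading_lt lx _; rewrite sub0r.
Qed.

(** If [x] is negative, the denominator is led by 1. If [x] is positive, it is led by [- tmon x],
    above the numerator 1, so the descending expansion has no constant term. *)
Lemma has_limit_geometric x : x != 0 ->
  has_limit (1 - tmon x)^-1 `[< P (- x) >]%:R.
Proof.
move=> x0; have l1 : leading 1 0 1 := leading1.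
have lx : leading (- tmon x) x (-1).
  have -> : - tmon x = ratC (-1) * tmon x by rewrite ratCN ratC1 mulN1r.
  exact: leading_term.
rewrite -[_^-1]mul1r; have [/asboolP Px|nPx] := boolP `[< P (- x) >].
  exists 1, (1 - tmon x), 0, 1; rewrite oner_eq0 mulr1; split=> //.
  rewrite -[X in leading _ _ X]addr0; apply: leadingD => //.
  by apply: leading_lt lx _; rewrite sub0r.
have Px : P x by case: (P_total x0) => // /asboolP; rewrite (negPf nPx).
have l1x : leading 1 x 0 by apply: leading_lt l1 _; rewrite subr0.
exists 1, (1 - tmon x), x, (-1); rewrite oppr_eq0 oner_eq0 mul0r; split=> //.
by rewrite -[X in leading _ _ X]add0r; apply: leadingD.
Qed.

Lemma has_limit_sum (I : Type) (r : seq I) (f : I -> ratfun n) (b : I -> rat) :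
    (forall i, has_limit (f i) (b i)) ->
  has_limit (\sum_(i <- r) f i) (\sum_(i <- r) b i).
Proof.
move=> fb; elim/big_ind2: _ => [|f1 b1 f2 b2|i _]; last exact: fb.
  by rewrite -(ratC0 n); apply: has_limitC.
exact: has_limitD.
Qed.

Lemma exists_largest (x : 'rV[int]_n) (L : seq 'rV[int]_n) :
  exists2 y, y \in x :: L & forall z, z \in x :: L -> z != y -> P (y - z).
Proof.
elim: L => [|w L [y yL max_y]].
  by exists x; rewrite ?inE // => z; rewrite inE => ->.
have [wy|ne] := eqVneq w y.
  exists y; first by move: yL; rewrite !inE => /orP[]->; rewrite ?orbT.
  move=> z; rewrite !inE orbCA => /orP[/eqP->|zL]; last by apply: max_y; rewrite inE.
  by rewrite wy eqxx.
have : y - w != 0 by rewrite subr_eq0 eq_sym.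
case/P_total => [yw|wy].
  exists y; first by move: yL; rewrite !inE => /orP[]->; rewrite ?orbT.
  move=> z; rewrite !inE orbCA => /orP[/eqP->//|zL]; apply: max_y; by rewrite inE.
rewrite opprB in wy; exists w; first by rewrite !inE eqxx orbT.
move=> z; rewrite !inE orbCA => /orP[/eqP->|zL _]; first by rewrite eqxx.
have [->//|zy] := eqVneq z y; rewrite -(subrK y w) -addrA.
by apply: P_add => //; apply: max_y => //; rewrite inE.
Qed.

(** Let [y] be the largest among [v] and the support. If [y] is [v], comparing leading terms gives
    the value; if [y] is above [v], the limit forces [phi y = 0], although [y] is then in the
    support. *)
Lemma has_limit_laurent (phi : laurent n) v b :
  has_limit (tmon (- v) * laurent_ratfun phi) b -> phi v = b.
Proof.
move=> [g [h [z [d [lh d0 lg e]]]]].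
have {e} e : h * tmon (- v) * laurent_ratfun phi = g.
  by rewrite -mulrA e mulrC divfK // (leading_neq0 lh).
have [y yL max_y] := exists_largest v (finsupp phi).
have lphi : leading (laurent_ratfun phi) y (phi y).
  exists [seq (phi x, x) | x <- finsupp phi & x != y].
    move=> t /mapP[x]; rewrite mem_filter => /andP[xy xphi] ->.
    by apply: max_y => //; rewrite inE xphi orbT.
  rewrite /terms_ratfun big_map big_filter /laurent_ratfun.
  (* Outside the support [y] can only be [v], and the leading coefficient recorded is the default
     value 0. *)
  have [yphi|yphi] := boolP (y \in finsupp phi).
    by rewrite (bigD1_seq y) ?fset_uniq.
  rewrite (fsfun_dflt yphi) ratC0 mul0r add0r [RHS]big_seq_cond [LHS]big_seq.
  by apply: eq_bigl => x; case: eqP => [->|_]; rewrite ?(negPf yphi) ?andbT.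
have lv : leading (tmon (- v)) (- v) 1.
  by rewrite -[tmon _]mul1r -ratC1; apply: leading_term.
have := leadingM (leadingM lh lv) lphi; rewrite e mulr1 -addrA => lg'.
have [yv|yv] := eqVneq y v.
  rewrite yv addNr addr0 in lg'; apply: (mulIf d0).
  by rewrite (leading_uniq lg lg') mulrC.
have Pyv : P (y - v) by apply: max_y; rewrite ?inE ?eqxx // eq_sym.
have lt : leading g (z + (- v + y)) 0.
  by apply: leading_lt lg _; rewrite addrC addKr addrC.
have := leading_uniq lg' lt; move/eqP; rewrite mulf_eq0 (negPf d0) /=.
move: yL; rewrite inE (negPf yv) /= mem_finsupp => phiy /eqP e0.
by rewrite e0 eqxx in phiy.
Qed.

End LeadingTerm.

(** * Cones spanned by the roots of a relation, and their ray sums *)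

Section OrderCones.
Import fintype boot.finset.
Variables (R : realFieldType) (n : nat).
Implicit Types (D : rel 'I_n) (i j a b : 'I_n).

Notation rroot i j := (int_point R (rootv i j)).

Definition rel_cone D : set 'rV[R]_n :=
  Cone (fun x => exists i j, D i j /\ x = rroot i j).

Lemma rel_cone_closed D : cone_closed (rel_cone D).
Proof. exact: Cone_closed. Qed.

Lemma rel_cone_root D i j : D i j -> rel_cone D (rroot i j).
Proof. by move=> Dij; apply: Cone_gen; exists i, j. Qed.

Lemma rel_cone_min (K : set 'rV[R]_n) D x : cone_closed K ->
  (forall i j, D i j -> K (rroot i j)) -> rel_cone D x -> K x.
Proof.
by move=> cK KD; apply: Cone_min => // _ [i [j [/KD ? ->]]].
Qed.

Lemma rootv_id i : rootv i i = 0.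
Proof. exact: subrr. Qed.

Lemma rootv_neq0 i j : i != j -> rootv i j != 0.
Proof.
move=> ij; apply/eqP => /rowP/(_ i); rewrite !mxE !eqxx (negPf ij).
by rewrite subr0.
Qed.

(** The Minkowski sum of [C] with the ray spanned by [r]. *)
Definition ray_sum (C : set 'rV[R]_n) (r : 'rV[R]_n) : set 'rV[R]_n :=
  fun x => exists2 c, 0 <= c & C (x - c *: r).

Lemma ray_sum_closed C r : cone_closed C -> cone_closed (ray_sum C r).
Proof.
move=> [C0 CD CZ]; split.
- by exists 0; rewrite ?scale0r ?subrr.
- move=> x y [c c0 Cx] [d d0 Cy]; exists (c + d); first exact: addr_ge0.
  by rewrite scalerDl opprD addrACA; apply: CD.
- move=> e x e0 [c c0 Cx]; exists (e * c); first exact: mulr_ge0.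
  by rewrite -scalerA -scalerBr; apply: CZ.
Qed.

(** A new relation runs from [i] to [a], across to [b], and on to [j], so its root is that of
    [(a, b)] plus at most two roots of [D]. This covers both adjoining a maximum to a chain and
    refining a partial order. *)
Lemma rel_cone_ray D D' a b x :
    (forall i j, D i j -> D' i j) -> D' a b ->
    (forall i j, D' i j ->
      D i j \/ (i = a \/ D i a) /\ (j = b \/ D b j)) ->
  rel_cone D' x <-> ray_sum (rel_cone D) (rroot a b) x.
Proof.
move=> DD' Dab D'D; have [C0 CD CZ] := rel_cone_closed D.
have [C'0 C'D C'Z] := rel_cone_closed D'.
split=> [|[c c0 Cx]].
  apply: rel_cone_min; first by apply: ray_sum_closed; apply: rel_cone_closed.
  move=> i j /D'D[Dij|[ia bj]].
    by exists 0; rewrite ?scale0r ?subr0 //; apply: rel_cone_root.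
  exists 1; rewrite ?ler01 // scale1r.
  have E (l p q : 'I_n) : rroot l q = rroot l p + rroot p q by rewrite -int_pointD rootvD.
  have -> : rroot i j - rroot a b = rroot i a + rroot b j.
    rewrite (E i a j) (E a b j); move: (rroot i a) (rroot a b) => p q.
    by rewrite [q + _]addrC addrA addrK.
  have root0 (l : 'I_n) : rel_cone D (rroot l l) by rewrite rootv_id /int_point map_mx0.
  apply: CD; first by case: ia => [->|/rel_cone_root].
  by case: bj => [->|/rel_cone_root].
rewrite -(subrK (c *: rroot a b) x); apply: C'D.
  by apply: rel_cone_min Cx => [|i j /DD'/rel_cone_root//]; apply: rel_cone_closed.
by apply: C'Z => //; apply: rel_cone_root.
Qed.

Lemma ray_sumI (C : set 'rV[R]_n) r x : cone_closed C ->
  ray_sum C r x -> ray_sum C (- r) x -> C x.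
Proof.
move=> [C0 CD CZ] [c c0 Cx] [d d0 Cx'].
move: c0; rewrite le_eqVlt => /orP[/eqP ce|c0].
  by rewrite -ce scale0r subr0 in Cx.
have cd0 : 0 < c + d by rewrite ltr_wpDr.
(* [x] lies on the segment joining the two translates known to be in [C]. *)
suff -> : x = (c + d)^-1 *: (d *: (x - c *: r) + c *: (x - d *: - r)).
  by apply: (CZ); [rewrite invr_ge0 ltW|apply: CD; apply: (CZ) => //; apply: ltW].
apply: (scalerI (lt0r_neq0 cd0)); rewrite scalerA mulfV ?lt0r_neq0 // scale1r.
apply/rowP => i; rewrite !mxE; ring.
Qed.

(* The identity of indicator functions [C] + [C + R r] = [C + R+ r] + [C - R+ r]. *)
Lemma finite_series_split (C : set 'rV[R]_n) (r : 'rV[int]_n) f g :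
    cone_closed C -> r != 0 ->
    finite_series f (lattice_series (ray_sum C (int_point R r))) ->
    finite_series g (lattice_series (ray_sum C (int_point R (- r)))) ->
  finite_series (f + g) (lattice_series C).
Proof.
move=> cC r0 ff fg; have [C0 CD CZ] := cC.
(* The union of the two ray sums is [line] and their intersection is [C]; the indicator of [line] is
   periodic along [r], so it contributes 0. *)
pose line (x : 'rV[R]_n) := exists c, C (x - c *: int_point R r).
have lineE x : line x <-> ray_sum C (int_point R r) x \/
    ray_sum C (int_point R (- r)) x.
  split=> [[c Cx]|].
    have [c0|/ltW c0] := leP 0 c; [by left; exists c|right].
    by exists (- c); rewrite ?oppr_ge0 // int_pointN scalerN scaleNr opprK.
  case=> [[c _ Cx]|[c _]]; first by exists c.
  by rewrite int_pointN scalerN -scaleNr => Cx; exists (- c).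
pose s x : rat := - (`[< line (int_point R x) >])%:R.
have fs : finite_series 0 s.
  apply: (finite_series_periodic r0) => x; congr (- (nat_of_bool _)%:R).
  apply: asbool_equiv_eq; rewrite int_pointD int_pointN.
  split=> [[c Cx]|[c Cx]]; [exists (1 + c)|exists (c - 1)].
    by rewrite scalerDl scale1r opprD addrA.
  by rewrite scalerBl scale1r opprB addrA subrK.
have := finite_seriesD (finite_seriesD ff fg) fs; rewrite addr0.
apply: eq_finite_series => x; rewrite /s /lattice_series.
set y := int_point R x.
have sub1 t : C y -> ray_sum C t y by move=> Cy; exists 0; rewrite ?scale0r ?subr0.
have -> : `[< C y >] = `[< ray_sum C (int_point R r) y >] &&
    `[< ray_sum C (int_point R (- r)) y >].
  apply/asboolP/andP => [Cy|[/asboolP Cp /asboolP]].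
    by split; apply/asboolP; apply: sub1.
  by rewrite int_pointN => Cm; apply: ray_sumI Cp Cm.
rewrite (asbool_equiv_eq (lineE y)) asbool_or.
by case: `[< _ >]; case: `[< _ >].
Qed.

Definition strict_order D : Prop := irreflexive D /\ transitive D.

Definition rel_on D (A : {set 'I_n}) : rel 'I_n :=
  fun i j => [&& i \in A, j \in A & D i j].

(** An element of [A] with the most predecessors is maximal: anything above it would have these
    predecessors and the element itself. *)
Lemma exists_max D (A : {set 'I_n}) : strict_order D ->
    (forall i j, i != j -> D i j || D j i) -> A != set0 ->
  exists2 b, b \in A & forall i, i \in A -> i != b -> D i b.
Proof.
move=> [irr tr] tot /set0Pn[i0 i0A].
have [b bA max_b] := arg_maxnP (fun b => #|[set j | D j b]|) i0A.
exists b => // i iA ib; case/orP: (tot _ _ ib) => // Dbi.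
have := max_b i iA; apply/contraTT => _; rewrite -ltnNge; apply: proper_card.
apply/properP; split; last by exists b; rewrite !inE ?irr.
by apply/subsetP => j; rewrite !inE => Djb; apply: tr Djb Dbi.
Qed.

Lemma lattice_series_eq (C C' : set 'rV[R]_n) :
  (forall x, C x <-> C' x) -> lattice_series C =1 lattice_series C'.
Proof.
by move=> e x; congr (nat_of_bool _)%:R; apply: asbool_equiv_eq.
Qed.

(* [C + R+ r] is tiled by the translates of [C] by multiples of [r]. *)
Lemma geometric_ray (C : set 'rV[R]_n) a b (x : 'rV[int]_n) : a != b ->
    (forall y, C y -> y 0 b = 0) ->
  lattice_series (ray_sum C (rroot a b)) x
    - lattice_series (ray_sum C (rroot a b)) (x - rootv a b)
  = lattice_series C x.
Proof.
move=> ab Cb; rewrite /lattice_series.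
have rb : rootv a b 0 b = -1 by rewrite !mxE !eqxx eq_sym (negPf ab) sub0r.
(* On [C] coordinate [b] vanishes and the root has [b]-coordinate -1, so the multiple of the root is
   forced to be [- y 0 b], an integer. *)
have E y : ray_sum C (rroot a b) (int_point R y) <->
    y 0 b <= 0 /\ C (int_point R (y + y 0 b *: rootv a b)).
  have eq_y c : - c = (y 0 b)%:~R ->
      int_point R y - c *: rroot a b = int_point R (y + y 0 b *: rootv a b).
    by move=> cE; rewrite -scaleNr cE; apply/rowP => i; rewrite !mxE; ring.
  split=> [[c c0 Cy]|[yb Cy]].
    have cE : - c = (y 0 b)%:~R.
      have : (int_point R y - c *: rroot a b) 0 b = (y 0 b)%:~R + c.
        rewrite !mxE !eqxx [b == a]eq_sym (negPf ab) sub0r rmorphN1 mulrN1.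
        by rewrite opprK.
      by rewrite (Cb _ Cy) => /esym/eqP; rewrite addr_eq0 => /eqP->.
    by rewrite -(eq_y c cE) -(ler_int R) -cE oppr_le0.
  exists (- (y 0 b)%:~R); first by rewrite oppr_ge0 (ler_int R _ 0).
  by rewrite (eq_y _ (opprK _)).
rewrite !(asbool_equiv_eq (E _)).
have -> : (x - rootv a b) 0 b = x 0 b + 1 by rewrite mxE [X in _ + X]mxE rb opprK.
have -> : x - rootv a b + (x 0 b + 1) *: rootv a b = x + x 0 b *: rootv a b.
  by rewrite scalerDl scale1r [_ *: _ + _]addrC addrA subrK.
have -> : `[< C (int_point R x) >] =
    (x 0 b == 0) && `[< C (int_point R (x + x 0 b *: rootv a b)) >].
  have [->|xb] := eqVneq (x 0 b) 0; first by rewrite scale0r addr0.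
  apply/asboolP => /Cb; rewrite mxE => /eqP; rewrite intr_eq0.
  by rewrite (negPf xb).
rewrite !asbool_and !asboolb.
case: `[< _ >]; rewrite ?andbF ?andbT ?subr0 //.
have [xb|xb] := leP (x 0 b) 0; have [xb'|xb'] := leP (x 0 b + 1) 0;
  have [xb''|xb''] := eqVneq (x 0 b) 0 => //; exfalso; lia.
Qed.

End OrderCones.

Arguments rel_cone R {n} D.

(** * Limits of the Hilbert series of order cones *)

Section OrderConeLimit.
Import fintype boot.finset.
Variables (R : realFieldType) (n : nat) (P : 'rV[int]_n -> Prop).
Hypothesis P_add : forall x y, P x -> P y -> P (x + y).
Hypothesis P_irrefl : ~ P 0.
Hypothesis P_total : forall x, x != 0 -> P x \/ P (- x).
Implicit Types (D : rel 'I_n) (i j a b : 'I_n).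

Definition descends D : Prop := forall i j, D i j -> P (rootv j i).

Definition has_order_limit D : Prop :=
  exists2 f, finite_series f (lattice_series (rel_cone R D))
    & has_limit P f `[< descends D >]%:R.

(** If [b] is the maximum of the chain [A] and [a] the next largest element, adjoining [b] adds
    exactly the ray of [rootv a b], hence one geometric factor. The limit is 1 when all these roots
    are negative and 0 otherwise. *)
Lemma order_limit_on D (A : {set 'I_n}) : strict_order D ->
    (forall i j, i != j -> D i j || D j i) -> has_order_limit (rel_on D A).
Proof.
move=> sD tot; have [irr tr] := sD.
have [d] := ubnP #|A|; elim: d A => // d IH A; rewrite ltnS => le_d.
have [small|/card_gt1P[i0 [j0 [iA jA ij]]]] := leqP #|A| 1.
  have none i j : ~ rel_on D A i j.
    move=> /and3P[iA jA]; rewrite (card_le1_eqP small _ _ iA jA).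
    by rewrite irr.
  exists 1; last first.
    rewrite (_ : `[< _ >]) -?(ratC1 n); first exact: has_limitC.
    by apply/asboolP => i j /none.
  apply: eq_finite_series (finite_series_delta n) => x.
  suff e : (x == 0) = `[< rel_cone R (rel_on D A) (int_point R x) >].
    by rewrite /lattice_series -e.
  apply/eqP/asboolP => [->|].
    by rewrite /int_point map_mx0; case: (rel_cone_closed R (rel_on D A)).
  move=> Cx; apply: (@int_point_inj R); rewrite [RHS]map_mx0.
  pose K : set 'rV[R]_n := fun y => y = 0.
  apply: (@rel_cone_min _ _ K) Cx => [|i j /none//].
  by split=> // [_ _ ->->|c _ _ ->]; rewrite /K ?addr0 ?scaler0.
have A0 : A != set0 by apply/set0Pn; exists i0.
have [b bA max_b] := exists_max sD tot A0.
have A'0 : A :\ b != set0.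
  have [e|ne] := eqVneq i0 b; apply/set0Pn; [exists j0|exists i0].
    by rewrite !inE jA andbT -e eq_sym.
  by rewrite !inE ne.
have [a] := exists_max sD tot A'0; rewrite !inE => /andP[ab aA] max_a.
have [|f ff lf] := IH (A :\ b).
  by move: le_d; rewrite (cardsD1 b) bA.
have Dab : D a b by apply: max_b.
have sub i j : rel_on D (A :\ b) i j -> rel_on D A i j.
  by rewrite /rel_on !inE => /and3P[/andP[_ ->] /andP[_ ->]].
have onab : rel_on D A a b by rewrite /rel_on aA bA.
have dec i j : rel_on D A i j -> rel_on D (A :\ b) i j \/
    (i = a \/ rel_on D (A :\ b) i a) /\ (j = b \/ rel_on D (A :\ b) b j).
  move=> /and3P[iA' jA' Dij].
  have ib : i != b.
    apply: contraTneq Dij => ->; have [->|jb] := eqVneq j b; first by rewrite irr.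
    by apply/negP => /(tr _ _ _ (max_b _ jA' jb)); rewrite irr.
  have [->|jb] := eqVneq j b; last by left; rewrite /rel_on !inE ib jb iA' jA'.
  right; split; last by left.
  have [->|ia] := eqVneq i a; [by left|right].
  by rewrite /rel_on !inE ib ab iA' aA max_a // !inE ib.
exists (f / (1 - tmon (rootv a b))).
  apply: finite_series_geometric ff _; first exact: rootv_neq0.
  move=> x; rewrite !(lattice_series_eq (fun y => rel_cone_ray y sub onab dec)).
  apply: geometric_ray => // y.
  pose K : set 'rV[R]_n := fun y => y 0 b = 0.
  apply: (@rel_cone_min _ _ K) => [|i j].
    split; first by rewrite /K mxE.
      by move=> p q; rewrite /K mxE => -> ->; rewrite addr0.
    by move=> c p _; rewrite /K mxE => ->; rewrite mulr0.
  rewrite /rel_on !inE => /and3P[/andP[ib _] /andP[jb _] _].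
  by rewrite /K !mxE !eqxx ![b == _]eq_sym (negPf ib) (negPf jb) subrr.
have -> : `[< descends (rel_on D A) >]%:R =
    `[< descends (rel_on D (A :\ b)) >]%:R * `[< P (- rootv a b) >]%:R :> rat.
  rewrite -natrM mulnb -asbool_and; congr (nat_of_bool _)%:R.
  apply: asbool_equiv_eq; rewrite rootvN; split=> [dA|[dA' Pba] i j].
    by split; [move=> i j /sub/dA | apply: dA].
  case/dec => [/dA'//|[ia bj]]; rewrite -(rootvD j b i) -(rootvD b a i).
  have Pbi : P (rootv b a + rootv a i).
    case: ia => [->|/dA' Pai]; first by rewrite rootv_id addr0.
    exact: P_add.
  case: bj => [->|/dA' Pjb]; first by rewrite rootv_id add0r.
  exact: P_add.
apply: has_limitM => //; apply: has_limit_geometric => //.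
exact: rootv_neq0.
Qed.

(* Two incomparable elements are resolved both ways until the order is total. *)
Lemma order_limit D : strict_order D -> has_order_limit D.
Proof.
pose inc D := [set p : 'I_n * 'I_n | [&& p.1 != p.2, ~~ D p.1 p.2 & ~~ D p.2 p.1]].
have [d] := ubnP #|inc D|; elim: d D => // d IH D; rewrite ltnS => le_d sD.
have [irr tr] := sD.
have [inc0|[[a b]]] := set_0Vmem (inc D).
  have tot i j : i != j -> D i j || D j i.
    move=> ij; apply/negPn/negP; rewrite negb_or => /andP[nij nji].
    by have : (i, j) \in inc D; [rewrite inE /= ij nij | rewrite inc0 inE].
  have := order_limit_on [set: 'I_n] sD tot.
  rewrite (_ : rel_on D [set: 'I_n] = D) //.
  by apply/funext => i; apply/funext => j; rewrite /rel_on !inE.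
rewrite inE /= => /and3P[ab nab nba].
(* For incomparable [a] and [b] this is the transitive closure of [D] with the pair [(a, b)]
   added. *)
pose ext a b i j := D i j || ((i == a) || D i a) && ((j == b) || D b j).
have extP a' b' : a' != b' -> ~~ D a' b' -> ~~ D b' a' ->
    [/\ strict_order (ext a' b'), (#|inc (ext a' b')| < d)%N
      & forall x, rel_cone R (ext a' b') x <->
          ray_sum (rel_cone R D) (int_point R (rootv a' b')) x].
  move=> ab' nab' nba'; have extab : ext a' b' a' b'.
    by rewrite /ext !eqxx orbT.
  have sub i j : D i j -> ext a' b' i j by rewrite /ext => ->.
  split.
  - split=> [i|j i l]; rewrite /ext.
      rewrite irr /=; apply/negP => /andP[/orP[/eqP->|ia] /orP[/eqP e|bi]].
      + by rewrite e eqxx in ab'.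
      + by rewrite bi in nba'.
      + by rewrite -e ia in nba'.
      + by rewrite (tr _ _ _ bi ia) in nba'.
    move=> /orP[Dij|/andP[ia bj]] /orP[Djl|/andP[ja bl]].
    + by rewrite (tr _ _ _ Dij Djl).
    + rewrite bl andbT; case/orP: ja => [/eqP<-|ja]; first by rewrite Dij !orbT.
      by rewrite (tr _ _ _ Dij ja) !orbT.
    + rewrite ia /=; case/orP: bj => [/eqP<-|bj]; first by rewrite Djl !orbT.
      by rewrite (tr _ _ _ bj Djl) !orbT.
    + by rewrite ia bl orbT.
  - apply: leq_trans le_d; apply: proper_card; apply/properP; split.
      apply/subsetP => -[i j]; rewrite !inE /= => /and3P[-> nij nji] /=.
      by rewrite (contra (@sub _ _) nij) (contra (@sub _ _) nji).
    by exists (a', b'); rewrite !inE /= ?ab' ?nab' ?nba' // extab.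
  - move=> x; apply: rel_cone_ray => // i j; rewrite /ext => /orP[|]; first by left.
    move=> /andP[ia bj]; right; split; [case/orP: ia|case/orP: bj];
      by [move=> /eqP; left | right].
have [s1 lt1 e1] := extP _ _ ab nab nba.
have [|//|//|s2 lt2 e2] := extP b a; first by rewrite eq_sym.
have [f ff lf] := IH _ lt1 s1; have [g fg lg] := IH _ lt2 s2.
exists (f + g).
  apply: (finite_series_split (rel_cone_closed R D) (rootv_neq0 ab)).
    by apply: eq_finite_series ff; apply: lattice_series_eq.
  by rewrite rootvN; apply: eq_finite_series fg; apply: lattice_series_eq.
have descE a' b' : descends (ext a' b') <-> descends D /\ P (rootv b' a').
  split=> [dE|[dD Pba] i j].
    split=> [i j Dij|]; apply: dE; rewrite /ext ?Dij //.
    by rewrite !eqxx orbT.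
  rewrite /ext => /orP[/dD//|/andP[ia bj]].
  rewrite -(rootvD j b' i) -(rootvD b' a' i).
  have Pbi : P (rootv b' a' + rootv a' i).
    case/orP: ia => [/eqP->|/dD Pai]; first by rewrite rootv_id addr0.
    exact: P_add.
  case/orP: bj => [/eqP->|/dD Pjb]; first by rewrite rootv_id add0r.
  exact: P_add.
have := has_limitD P_add P_irrefl lf lg.
rewrite !(asbool_equiv_eq (descE _ _)) !asbool_and -natrD.
(* Exactly one of two opposite roots is positive, so if [D] descends then exactly one of its two
   refinements does. *)
suff -> : (`[< descends D >] && `[< P (rootv b a) >] +
           `[< descends D >] && `[< P (rootv a b) >])%N = `[< descends D >] by [].
have := P_total (rootv_neq0 ab); rewrite rootvN => Pab.
have nP : ~ (P (rootv a b) /\ P (rootv b a)).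
  by move=> [p q]; apply: P_irrefl; rewrite -(rootv_id a) -(rootvD a b a); apply: P_add.
case: (boolP `[< P (rootv b a) >]) => [/asboolP p|/asboolPn p];
  case: (boolP `[< P (rootv a b) >]) => [/asboolP q|/asboolPn q].
- by case: nP.
- by rewrite andbT andbF addn0.
- by rewrite andbT andbF.
- by case: Pab.
Qed.

End OrderConeLimit.

(** * The lexicographic order given by a list of functionals *)

Section LexOrder.
Variables (R : realFieldType) (n : nat).
Implicit Types (us : seq 'rV[R]_n) (x y : 'rV[R]_n).

Fixpoint lexpos us x : bool :=
  if us is u :: us' then (0 < dot u x) || (dot u x == 0) && lexpos us' x
  else false.

Lemma lexposD us x y : lexpos us x -> lexpos us y -> lexpos us (x + y).
Proof.
elim: us => //= u us IH; rewrite dotDr.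
case/orP=> [ux|/andP[/eqP-> px]]; case/orP=> [uy|/andP[/eqP-> py]].
- by rewrite addr_gt0.
- by rewrite addr0 ux.
- by rewrite add0r uy.
- by rewrite addr0 eqxx IH ?orbT.
Qed.

Lemma lexposZ us c x : 0 < c -> lexpos us x -> lexpos us (c *: x).
Proof.
move=> c0; elim: us => //= u us IH; rewrite dotZr pmulr_rgt0 //.
by case/orP=> [->//|/andP[/eqP-> /IH->]]; rewrite mulr0 eqxx orbT.
Qed.

Lemma lexpos0 us : ~~ lexpos us 0.
Proof. by elim: us => //= u us /negPf->; rewrite dot0r ltxx andbF. Qed.

Lemma lexpos_total us x :
  lexpos us x || lexpos us (- x) || all (fun u => dot u x == 0) us.
Proof.
elim: us => //= u us IH; rewrite dotNr oppr_gt0 oppr_eq0.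
by case: (ltgtP (dot u x) 0) => //=; rewrite ?orbT.
Qed.

Definition lex_le us : set 'rV[R]_n := fun x => x = 0 \/ lexpos us (- x).

Lemma lex_le_closed us : cone_closed (lex_le us).
Proof.
split; first by left.
- move=> x y [->|px]; rewrite ?add0r // => -[->|py]; first by right; rewrite addr0.
  by right; rewrite opprD; apply: lexposD.
- move=> c x + [->|px]; first by left; rewrite scaler0.
  rewrite le_eqVlt => /orP[/eqP<-|c0]; first by left; rewrite scale0r.
  by right; rewrite -scalerN; apply: lexposZ.
Qed.

End LexOrder.

(** * A functional exposing [v] and monotone in its coordinates *)

Section VertexFunctional.
Variables (R : realFieldType) (n : nat) (I : Type) (w : I -> 'rV[int]_n).
Variable v : 'rV[int]_n.
Hypothesis v_vertex : is_vertex (perm_polytope R w) (int_point R v).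

Let orbit_point (x : 'rV[int]_n) : Prop :=
  exists (s : 'S_n) (l : I), x = col_perm s (w l).

(** Otherwise the exposing functional is strictly smaller at every point of the convex combination,
    which forces all weights to vanish. *)
Lemma Conv_vertex (X : set 'rV[R]_n) p : is_vertex (Conv X) p -> X p.
Proof.
move=> [[m [c [q [c0 c1 Xq pE]]]] [u max_u]].
have [[i <-]|none] := pselect (exists i, q i = p); first exact: Xq.
have lt i : dot u (q i) < dot u p.
  apply: max_u; first exact: Conv_gen.
  by move=> e; apply: none; exists i.
have sum0 : \sum_i c i * (dot u p - dot u (q i)) = 0.
  under eq_bigr do rewrite mulrBr.
  rewrite sumrB -mulr_suml c1 mul1r; apply/eqP; rewrite subr_eq0; apply/eqP.
  rewrite {1}pE; elim/big_rec2: _ => [|i a b _ <-]; first by rewrite dot0r.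
  by rewrite dotDr dotZr.
have c_eq0 i : c i = 0.
  have /eqP := psumr_eq0P (fun i _ => mulr_ge0 (c0 i)
    (ltW (eq_ind_r (fun x => is_true x) (lt i) (subr_gt0 _ _)))) sum0 (i := i) isT.
  by rewrite mulf_eq0 subr_eq0 (gt_eqF (lt i)) orbF => /eqP.
move: c1; rewrite big1 // => /esym/eqP; by rewrite oner_eq0.
Qed.

Lemma vertex_orbit_point : orbit_point v.
Proof.
have [s [l e]] := Conv_vertex v_vertex.
by exists s, l; apply: int_point_inj e.
Qed.

Lemma orbit_point_perm s x : orbit_point x -> orbit_point (col_perm s x).
Proof.
by move=> [t [l ->]]; exists (s * t)%g, l; rewrite col_permM.
Qed.

Lemma dot_col_perm (s : 'S_n) (u x : 'rV[R]_n) :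
  dot (col_perm s u) x = dot u (col_perm s^-1 x).
Proof.
rewrite /dot (reindex_inj (@perm_inj _ s^-1)); apply: eq_bigr => i _.
by rewrite !mxE permKV.
Qed.

(* Averaging an exposing functional over the stabilizer of [v] makes it a
   monotone function of the coordinates of [v]. *)
Lemma vertex_functional : exists2 u : 'rV[R]_n,
    forall x, orbit_point x -> x <> v -> 0 < dot u (int_point R (v - x))
  & forall i j, v 0 i <= v 0 j -> u 0 i <= u 0 j.
Proof.
have [_ [u0 max_u0]] := v_vertex.
pose stab (s : 'S_n) := col_perm s v == v.
pose u := \sum_(s | stab s) col_perm s u0.
have dotu x : dot u x = \sum_(s | stab s) dot u0 (col_perm s^-1 x).
  under [RHS]eq_bigr do rewrite -dot_col_perm.
  rewrite exchange_big; apply: eq_bigr => i _.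
  by rewrite summxE mulr_suml.
have max_u x : orbit_point x -> x <> v -> 0 < dot u (int_point R (v - x)).
  move=> xO xv; rewrite dotu.
  (* Stabilizer elements fix [v] and permute the orbit points, so every summand of the average is
     positive. *)
  have pos s : stab s -> 0 < dot u0 (col_perm s^-1 (int_point R (v - x))).
    move=> /eqP sv.
    have vs : v = col_perm s^-1 v by rewrite -{2}sv -col_permM mulVg col_perm1.
    have -> : col_perm s^-1 (int_point R (v - x)) =
        int_point R v - int_point R (col_perm s^-1 x).
      rewrite {2}vs -int_pointN -int_pointD; apply/rowP => i.
      by rewrite !mxE.
    rewrite dotBr subr_gt0; apply: max_u0.
      have [t [l ->]] := orbit_point_perm s^-1 xO.
      by apply: Conv_gen; exists t, l.
    move=> /int_point_inj e; apply: xv.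
    by rewrite -sv -e -col_permM mulgV col_perm1.
  have stab1 : stab 1%g by rewrite /stab col_perm1.
  rewrite (bigD1 1%g) //= ltr_pwDl ?pos //.
  by apply: sumr_ge0 => s /andP[/pos/ltW].
exists u => // i j; set t := tperm i j; rewrite le_eqVlt.
case/orP=> [/eqP vij|lt_ij].
  (* The transposition lies in the stabilizer; left translation by it permutes the summands and
     identifies coordinates [i] and [j] of [u]. *)
  have tv : col_perm t v = v.
    by apply/rowP => l; rewrite mxE /t; case: tpermP => [->|->|].
  rewrite !summxE [X in X <= _](reindex_inj (mulgI t)) /=.
  rewrite le_eqVlt; apply/orP; left; apply/eqP; apply: eq_big => s.
    rewrite /stab col_permM; apply/eqP/eqP => [e|->//].
    by rewrite -[col_perm s v]col_perm1 -(tperm2 i j) col_permM e.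
  by rewrite !mxE permM tpermL.
(* Swapping the two coordinates moves [v] by a positive multiple of a root, and [u] strictly
   decreases away from [v]. *)
have tv : v - col_perm t v = (v 0 j - v 0 i) *: rootv j i.
  apply/rowP => l; rewrite !mxE !eqxx /= /t.
  have [->|li] := eqVneq l i.
    rewrite tpermL; have [e|_] := eqVneq i j; first by rewrite e ltxx in lt_ij.
    by rewrite sub0r mulrN1 opprB.
  have [->|lj] := eqVneq l j; first by rewrite tpermR subr0 mulr1.
  by rewrite tpermD 1?eq_sym // !subrr mulr0.
have := max_u _ (orbit_point_perm t vertex_orbit_point).
have -> : int_point R (v - col_perm t v) =
    (v 0 j - v 0 i)%:~R *: int_point R (rootv j i).
  by rewrite tv; apply/rowP => l; rewrite !mxE rmorphM.
rewrite dotZr dot_root pmulr_rgt0 ?ltr0z ?subr_gt0 // => h; apply/ltW/h.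
move=> /rowP/(_ i) e; move: lt_ij.
by rewrite -e mxE /t tpermL ltxx.
Qed.

End VertexFunctional.

(** * Basis cones as order cones *)

Section BasisConeLimit.
Variables (R : realFieldType) (n k : nat) (M : flag_matroid n k).
Implicit Types (B : flag n k) (i j : 'I_n).

Definition basis_order B : rel 'I_n :=
  fun i j => (i != j) && `[< basis_cone R M B (int_point R (rootv i j)) >].

(** Transitivity also requires distinct endpoints: two opposite roots cannot both lie in the cone,
    as [evec_flag R B] would be negative on both. *)
Lemma basis_order_strict B : flag_basis M B -> strict_order (basis_order B).
Proof.
move=> BM; split=> [i|j i l]; first by rewrite /basis_order eqxx.
rewrite /basis_order => /andP[ij /asboolP Cij] /andP[jl /asboolP Cjl].
have [_ CD _] := basis_cone_closed R M B.
apply/andP; split; last by apply/asboolP; rewrite -(rootvD i j l) int_pointD; apply: CD.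
have neg i' j' : i' != j' -> basis_cone R M B (int_point R (rootv i' j')) ->
    dot (evec_flag R B) (int_point R (rootv i' j')) < 0.
  move=> ne C; apply: basis_cone_dot_lt BM C _; apply: contraNneq (rootv_neq0 ne).
  by rewrite -(map_mx0 (intr : int -> R)) => e; apply/eqP/(@int_point_inj R).
apply/eqP => il; move: (neg _ _ ij Cij) (neg _ _ jl Cjl); rewrite !dot_root -il.
by lra.
Qed.

(** The exchange roots generate the cone by [basis_cone_exchange_min] and belong to it by
    [flag_exchange_cone]. *)
Lemma basis_coneE B : flag_basis M B ->
  forall x, rel_cone R (basis_order B) x <-> basis_cone R M B x.
Proof.
move=> BM x; split.
  by apply: rel_cone_min => [|i j /andP[_ /asboolP]//]; apply: basis_cone_closed.
apply: basis_cone_exchange_min => // [|j a b ex]; first exact: rel_cone_closed.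
apply: rel_cone_root; rewrite /basis_order; apply/andP; split.
  by case: ex => aB bB _; apply: contraNneq bB => ->.
by apply/asboolP; apply: flag_exchange_cone ex.
Qed.

Variable us : seq 'rV[R]_n.
Let P (x : 'rV[int]_n) : Prop := lexpos us (int_point R x).

(** For [B'] other than [B], the difference of their vectors lies in the cone at [B] and its
    opposite in the cone at [B']; the two cannot both be negative. *)
Lemma basis_order_descends B B' : flag_basis M B -> flag_basis M B' ->
    (forall x, basis_cone R M B x -> lex_le us x) ->
  descends P (basis_order B') <-> B' = B.
Proof.
move=> BM B'M le_B.
split=> [dB'|-> i j /andP[ij /asboolP Cij]]; last first.
  have [e|] := le_B _ Cij; last by rewrite -int_pointN rootvN.
  by case/eqP: (rootv_neq0 ij); apply: (@int_point_inj R); rewrite e [RHS]map_mx0.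
have le_B' x : basis_cone R M B' x -> lex_le us x.
  move=> /(basis_coneE B'M); apply: rel_cone_min; first exact: lex_le_closed.
  by move=> i j /dB' Pji; right; rewrite -int_pointN rootvN.
have [//|ne] := pselect (B' = B).
have := le_B' _ (basis_cone_gen R B' BM).
have := le_B _ (basis_cone_gen R B B'M).
have nz : evec_flag R B' - evec_flag R B <> 0.
  move=> /eqP; rewrite subr_eq0 => /eqP e.
  by have := dot_evec_flag_lt R BM B'M ne; rewrite e ltxx.
rewrite /lex_le opprB => -[//|p] [/eqP|q].
  by rewrite -oppr_eq0 opprB => /eqP.
rewrite opprB in q.
by have := lexposD p q; rewrite addrA subrK subrr (negPf (lexpos0 _)).
Qed.

End BasisConeLimit.

Theorem theorem4p11 (R : realFieldType) (n k : nat) (M : flag_matroid n k)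
    (Lambda : finType) (a : Lambda -> rat) (w : Lambda -> 'rV[int]_n)
    (BL : Lambda -> flag n k) (c : int) (phi : laurent n)
    (m : nat) (S : 'I_m -> {set 'I_n}) (v : 'rV[int]_n) (B : flag n k)
    (w_ge0 : forall l i, 0 <= w l 0 i)
    (BL_basis : forall l, flag_basis M (BL l))
    (w_sum : forall l, \sum_(i < n) w l 0 i = c)
    (phi_def : laurent_ratfun phi =
       \sum_(l : Lambda) ratC (a l) * tmon (w l) * Hilb (basis_cone R M (BL l)))
    (v_vertex : is_vertex (perm_polytope R w) (int_point R v))
    (S_chain : is_chain S)
    (v_def : v = \sum_(i < m) evec int (S i))
    (B_basis : flag_basis M B)
    (SB : forall (i : 'I_m) (j : 'I_k), #|S i :&: B j| = rk (M j) (S i)) :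
  phi v = \sum_(l : Lambda | (w l == v) && (BL l == B)) a l.
Proof.
have [u max_u mono_u] := vertex_functional v_vertex.
(* [u] puts [v] above all other orbit points, [evec_flag R B] settles the vectors of the cone at [B]
   where [u] vanishes, and the coordinates make the order total. *)
pose us := [:: u, evec_flag R B & [seq delta_mx 0 i | i <- enum 'I_n]].
pose P (x : 'rV[int]_n) : Prop := lexpos us (int_point R x).
have P_add x y : P x -> P y -> P (x + y).
  by rewrite /P int_pointD; apply: lexposD.
have P_irrefl : ~ P 0.
  by rewrite /P /int_point map_mx0; apply/negP/lexpos0.
have P_total x : x != 0 -> P x \/ P (- x).
  move=> x0; rewrite /P int_pointN.
  have /orP[/orP|/and3P[_ _ /allP all0]] := lexpos_total us (int_point R x); first by [].
  case/eqP: x0; apply/rowP => i.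
  have /all0 := map_f (fun i => delta_mx 0 i : 'rV[R]_n) (mem_enum 'I_n i).
  rewrite /dot (bigD1 i) //= big1 => [|j ne]; rewrite !mxE !eqxx ?(negPf ne) ?mul0r //.
  by rewrite mul1r addr0 intr_eq0 => /eqP.
(* A basis maximal for [v] is maximal for [u]: an exchange [B_j - y + x] keeps
   [|S_i :&: B_j|] at most its maximum, so [v] cannot increase from [y] to [x]. *)
have le_B x : basis_cone R M B x -> lex_le us x.
  move=> Cx; have [->|x0] := eqVneq x 0; [by left|right].
  (* The second functional is strictly negative at a nonzero [x] of the cone, so only the weak
     inequality for [u] remains. *)
  rewrite /= !dotNr !oppr_gt0 (basis_cone_dot_lt B_basis Cx x0) orTb andbT.
  rewrite oppr_eq0 orbC -le_eqVlt.
  pose K : set 'rV[R]_n := fun y => dot u y <= 0.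
  apply: (@basis_cone_exchange_min _ _ _ _ _ K) Cx => // [|j y z [yB zB yz]].
    split; first by rewrite /K dot0r.
      by move=> p q; rewrite /K dotDr => p0 q0; rewrite -[0]addr0 lerD.
    by move=> d p d0; rewrite /K dotZr; apply: mulr_ge0_le0.
  rewrite /K dot_root subr_le0; apply: mono_u.
  rewrite v_def !summxE; apply: ler_sum => i _; rewrite !mxE ler_nat.
  have [zS|//] := boolP (z \in S i); have [//|yS] := boolP (y \in S i).
  have := rk_ge (S i) yz; rewrite -SB leqNgt => /negP[]; apply: proper_card.
  apply/properP; split; last by exists z; rewrite !inE ?eqxx ?zS // (negPf zB).
  apply/fintype.subsetP => t; rewrite !inE => /andP[tS ->]; rewrite tS andbT.
  by rewrite (contraNneq _ yS) ?orbT // => <-.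
have lim_Hilb l : has_limit P (Hilb (basis_cone R M (BL l))) (BL l == B)%:R.
  have BLl := BL_basis l.
  have [f ff lf] :=
    order_limit R P_add P_irrefl P_total (basis_order_strict R BLl).
  have -> : Hilb (basis_cone R M (BL l)) = f.
    apply/Hilb_eq/represents_finite_series; apply: eq_finite_series ff.
    by apply: lattice_series_eq; apply: basis_coneE.
  suff <- : `[< descends P (basis_order R M (BL l)) >] = (BL l == B) by [].
  by apply/asboolP/eqP => /(basis_order_descends B_basis BLl le_B).
have lim_tmon l : has_limit P (tmon (w l - v)) (w l == v)%:R.
  have [->|ne] := eqVneq (w l) v.
    by rewrite subrr tmon0 -(ratC1 n); apply: has_limitC.
  apply: has_limit_tmon => //; rewrite opprB /P /=; apply/orP; left.
  apply: max_u; last exact/eqP.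
  by exists 1%g, l; rewrite col_perm1.
(* The coefficient is the limit of [tmon (- v) * laurent_ratfun phi], now computed summand by
   summand. *)
apply: (has_limit_laurent P_add P_irrefl P_total).
rewrite phi_def mulr_sumr [X in has_limit P _ X]big_mkcond /=.
apply: has_limit_sum => // l.
have -> : tmon (- v) * (ratC (a l) * tmon (w l) * Hilb (basis_cone R M (BL l))) =
    ratC (a l) * tmon (w l - v) * Hilb (basis_cone R M (BL l)).
  by rewrite tmonD mulrA mulrCA [tmon (- v) * tmon (w l)]mulrC.
have -> : (if (w l == v) && (BL l == B) then a l else 0) =
    a l * (w l == v)%:R * (BL l == B)%:R.
  by do 2![case: (_ == _)]; rewrite ?mulr1 ?mulr0 ?mul0r.
by do 2?apply: has_limitM => //; apply: has_limitC.
Qed.
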